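(* Let $p\ge1$, $m=2p$. Consider two systems $W_{k+1}(\lambda)-W_k(\lambda)=-\frac{i}{\lambda}j\widetilde C_kW_k(\lambda)$, $0\le k\le\widetilde N$, and $W_{k+1}(\lambda)-W_k(\lambda)=-\frac{i}{\lambda}j\widehat C_kW_k(\lambda)$, $0\le k\le\widehat N$, where $\widetilde C_k=2K^*\widetilde\beta(k)^*\widetilde\beta(k)K-j$, $\widehat C_k=2K^*\widehat\beta(k)^*\widehat\beta(k)K-j$ with $p\times m$ matrices satisfying $\widetilde\beta(k)J\widetilde\beta(k)^*=I_p$, $\widehat\beta(k)J\widehat\beta(k)^*=I_p$. Let $\widetilde\varphi$ be a Weyl function of the first system on $0\le k\le\widetilde N$ and $\widehat\varphi$ a Weyl function of the second system on $0\le k\le\widehat N$, and let $\{\widetilde\alpha_k\}$, $\{\widehat\alpha_k\}$ be the Taylor coefficients at $z=0$ of $i\widetilde\varphi\big(i\frac{z+1}{z-1}\big)$ and $i\widehat\varphi\big(i\frac{z+1}{z-1}\big)$. If $\widetilde\alpha_k=\widehat\alpha_k$ for all $k\le N$, where $N\le\min\{\widetilde N,\widehat N\}$, then $\widetilde C_k=\widehat C_k$ for all $k\le N$.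
   Context: $\mathbb C_-$ is the open lower half-plane; $j=\mathrm{diag}(I_p,-I_p)$, $J=\begin{bmatrix}0&I_p\\ I_p&0\end{bmatrix}$, $K=\frac1{\sqrt2}\begin{bmatrix}I_p&-I_p\\ I_p&I_p\end{bmatrix}$. For a system $W_{k+1}=W_k-\frac i\lambda jC_kW_k$ on $0\le k\le L$ with $W_0=I_m$, put $\mathcal W(\lambda)=\{\mathcal W_{ij}(\lambda)\}_{i,j=1}^2=KW_{L+1}(\bar\lambda)^*$ ($p\times p$ blocks). A Weyl function of the system on $0\le k\le L$ is a $p\times p$ matrix function $\varphi$ holomorphic in $\mathbb C_-$ of the form $\varphi=i(\mathcal W_{21}R+\mathcal W_{22}Q)(\mathcal W_{11}R+\mathcal W_{12}Q)^{-1}$, where $R,Q$ are $p\times p$ matrix functions meromorphic in $\mathbb C_-$, well defined at $\lambda=-i$, with $R^*R+Q^*Q>0$ and $R^*R\le Q^*Q$. *)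

(* Defs.v *)
(* Complex numbers are R[i] (real_closed's
   [complex]) over an abstract R : realType; R[i] is a numFieldType, hence a
   normed module over itself, so [derivable f z 1] with f : R[i]^o -> _ is
   complex (C-linear) differentiability. *)
From HB Require Import structures.
From mathcomp Require Import all_boot all_order all_algebra.
From mathcomp Require Import complex.
From mathcomp Require Import all_classical all_reals all_analysis.
Set Implicit Arguments. Unset Strict Implicit. Unset Printing Implicit Defensive.
Import Order.TTheory GRing.Theory Num.Theory.
Import numFieldNormedType.Exports.
Local Open Scope ring_scope.

Section Defs.
Variable R : realType.
Local Notation C := (R[i]).

Definition adj (m n : nat) (A : 'M[C]_(m, n)) : 'M[C]_(n, m) :=
  (map_mx Num.conj A)^T.

Definition jmat (p : nat) : 'M[C]_(p + p) := block_mx 1%:M 0 0 (- 1%:M).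
Definition Jmat (p : nat) : 'M[C]_(p + p) := block_mx 0 1%:M 1%:M 0.
Definition Kmat (p : nat) : 'M[C]_(p + p) :=
  (((Num.sqrt (2 : R))^-1)%:C)%C *: block_mx 1%:M (- 1%:M) 1%:M 1%:M.

Definition Cmat (p : nat) (beta : nat -> 'M[C]_(p, p + p)) (k : nat)
  : 'M[C]_(p + p) :=
  2%:R *: (adj (Kmat p) *m adj (beta k) *m beta k *m Kmat p) - jmat p.

Fixpoint Wsys (p : nat) (Cs : nat -> 'M[C]_(p + p)) (k : nat) (lam : C)
  : 'M[C]_(p + p) :=
  match k with
  | 0 => 1%:M
  | k'.+1 => Wsys Cs k' lam - ('i / lam) *: (jmat p *m Cs k' *m Wsys Cs k' lam)
  end.

Definition calW (p : nat) (Cs : nat -> 'M[C]_(p + p)) (L : nat) (lam : C)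
  : 'M[C]_(p + p) :=
  Kmat p *m adj (Wsys Cs L.+1 (Num.conj lam)).

Definition lowerH : set C := [set z | 'Im z < 0].

Definition holo_on (m n : nat) (D : set C) (f : C^o -> 'M[C]_(m, n)) :=
  forall z, D z -> derivable f z 1.

Definition regular_at (m n : nat) (f : C^o -> 'M[C]_(m, n)) (z : C) :=
  \forall w \near (z : C^o), derivable f w 1.

Definition meromorphic_on (m n : nat) (D : set C) (f : C^o -> 'M[C]_(m, n)) :=
  forall z0, D z0 -> exists (k : nat) (h : C^o -> 'M[C]_(m, n)),
    (\forall w \near (z0 : C^o), derivable h w 1) /\
    (\forall w \near dnbhs (z0 : C^o), f w = ((w - z0) ^+ k)^-1 *: h w).

Definition posdef (n : nat) (A : 'M[C]_n) :=
  forall v : 'cV[C]_n, v != 0 -> 0 < (adj v *m A *m v) 0 0.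
Definition psd (n : nat) (A : 'M[C]_n) :=
  forall v : 'cV[C]_n, 0 <= (adj v *m A *m v) 0 0.

Definition is_Weyl (p : nat) (Cs : nat -> 'M[C]_(p + p)) (L : nat)
  (phi : C^o -> 'M[C]_p) : Prop :=
  holo_on lowerH phi /\
  exists Rf Qf : C^o -> 'M[C]_p,
    [/\ meromorphic_on lowerH Rf, meromorphic_on lowerH Qf,
        regular_at Rf (- 'i), regular_at Qf (- 'i) &
        forall lam, lowerH lam -> regular_at Rf lam -> regular_at Qf lam ->
          let W := calW Cs L lam in
          let den := ulsubmx W *m Rf lam + ursubmx W *m Qf lam in
          let num := dlsubmx W *m Rf lam + drsubmx W *m Qf lam in
          [/\ posdef (adj (Rf lam) *m Rf lam + adj (Qf lam) *m Qf lam),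
              psd (adj (Qf lam) *m Qf lam - adj (Rf lam) *m Rf lam),
              den \in unitmx &
              phi lam = 'i *: (num *m invmx den)]].

Definition taylor_coef (p : nat) (phi : C^o -> 'M[C]_p) (k : nat) : 'M[C]_p :=
  (k`!%:R)^-1 *:
    derive1n k (fun z : C^o => 'i *: phi ('i * (z + 1) / (z - 1))) 0.

End Defs.

(* Main.v *)
Require Import Defs.
From HB Require Import structures.
From mathcomp Require Import all_boot all_order all_algebra.
From mathcomp Require Import complex.
From mathcomp Require Import all_classical all_reals all_analysis.
From mathcomp Require Import ring lra.

(* With [lambda = i (z + 1) / (z - 1)], the fundamental solution is, up to a
   scalar, the product of the factors [A_k = (1 - P_k) + z P_k], where
   [P_k = (1 + C_k j) / 2] is the projection along the [j]-negative space
   [ker (b_k j)] onto the range of [b_k^*], [b_k = beta_k K].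
   Suppose [C_k] agrees for [k < n].  Multiplying the two representations
   [K^* (I; -i phi) = A_0 ... A_L X] by the cofactors [z (1 - P_k) + P_k],
   [k < n], and dividing by [z^n] shows that agreement of the Taylor
   coefficients up to order [n] makes the two frames [A_n ... A_L X] equal at
   [z = 0].  This common frame [Y] is killed by [b_n j] for both systems, and it
   has rank [p] because the factors at [z = 0] map nonpositive vectors
   injectively to nonpositive vectors.  Hence both matrices [b_n j] have the
   left kernel of [Y] as row space, and [b_n j b_n^* = 1] determines
   [b_n^* b_n], that is, [C_n].
   Only complex differentiability is assumed, so reading the order of vanishing
   off the iterated derivatives needs that derivatives of holomorphic functions
   are holomorphic; this is obtained through Goursat's bisection and Cauchy's
   formula on squares, with the (nonzero, not computed) integral of
   [1 / (zeta - a)] as denominator. *)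

Set Implicit Arguments. Unset Strict Implicit. Unset Printing Implicit Defensive.
Import Order.TTheory GRing.Theory Num.Theory.
Import numFieldNormedType.Exports.
Local Open Scope ring_scope.
Local Open Scope classical_set_scope.

(** * Complex numbers: norm, neighbourhoods, integrals *)

(* The library norm of [R[i]] takes its values in [R[i]] itself. *)
Definition cnorm (R : realType) (z : R[i]) : R := ComplexField.Normc.normc z.

Section ComplexTopology.
Variable R : realType.
Local Notation C := (R[i]).
Local Notation N := (@cnorm R).

Lemma cnormE (z : C) : `|z| = (N z)%:C%C.
Proof. by []. Qed.

Lemma cnormM (x y : C) : N (x * y) = N x * N y.
Proof. exact: ComplexField.Normc.normcM. Qed.

Lemma cnormV (x : C) : N x^-1 = (N x)^-1.
Proof. exact: ComplexField.Normc.normcV. Qed.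

Lemma cnormD (x y : C) : N (x + y) <= N x + N y.
Proof. exact: le_normcD. Qed.

Lemma cnormN (x : C) : N (- x) = N x.
Proof. exact: normcN. Qed.

Lemma cnorm0 : N 0 = 0.
Proof. exact: ComplexField.Normc.normc0. Qed.

Lemma cnormi : N 'i = 1.
Proof. by rewrite /cnorm /= expr0n add0r expr1n sqrtr1. Qed.

Lemma cnorm_ge0 (z : C) : 0 <= N z.
Proof. by rewrite -lecR -cnormE normr_ge0. Qed.

Lemma cnormB (x y : C) : N (x - y) = N (y - x).
Proof. by apply: complexI; rewrite -!cnormE distrC. Qed.

Lemma cnorm_gt0 (z : C) : (0 < N z) = (z != 0).
Proof. by rewrite -ltcR -cnormE normr_gt0. Qed.

Lemma cnorm_real (x : R) : N x%:C%C = `|x|.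
Proof. by rewrite /cnorm /= expr0n addr0 sqrtr_sqr. Qed.

Lemma cnorm_Re (z : C) : `|complex.Re z| <= N z.
Proof.
case: z => x y; rewrite /cnorm /= -sqrtr_sqr ler_sqrt ?lerDl ?sqr_ge0//.
by rewrite addr_ge0 ?sqr_ge0.
Qed.

Lemma cnorm_Im (z : C) : `|complex.Im z| <= N z.
Proof.
case: z => x y; rewrite /cnorm /= -sqrtr_sqr ler_sqrt ?lerDr ?sqr_ge0//.
by rewrite addr_ge0 ?sqr_ge0.
Qed.

Lemma cnorm_ReIm (z : C) : N z <= `|complex.Re z| + `|complex.Im z|.
Proof.
rewrite {1}[z]complexE (le_trans (cnormD _ _))// cnormM.
by rewrite !cnorm_real cnormi mul1r.
Qed.

Lemma nbhsCP (a : C) (P : set C) :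
  nbhs (a : C^o) P <-> exists2 e : R, 0 < e & forall w, N (w - a) < e -> P w.
Proof.
split=> [/nbhs_ballP[[e e'] /=]|[e e0 H]].
  rewrite ltcE /= => /andP[/eqP -> e0] H; exists e => // w wa; apply: H.
  by rewrite -ball_normE /= distrC cnormE ltcR.
apply/nbhs_ballP; exists e%:C%C => /=; first by rewrite ltcR.
by move=> w; rewrite -ball_normE /= distrC cnormE ltcR => /H.
Qed.

(* A constant, because [Filter (nbhs (z : C^o))] is not inferred for the concrete
   field [R[i]]. *)
Definition cnbhs (z : C) : set_system C^o := nbhs (z : C^o).

Global Instance cnbhs_filter z : ProperFilter (cnbhs z).
Proof. exact: (@nbhs_pfilter C^o). Qed.

Lemma cvgCP (T : Type) (F : set_system T) (FF : Filter F) (f : T -> C^o) (l : C) :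
  (f x @[x --> F] --> (l : C^o)) <->
  forall e : R, 0 < e -> \forall x \near F, N (f x - l) < e.
Proof.
split=> [fl e e0|H].
  by apply: (fl [set w | N (w - l) < e]); apply/nbhsCP; exists e.
by move=> P /nbhsCP[e e0 eP]; apply: filterS (H e e0) => x /eP.
Qed.

Lemma continuous_Re : continuous (@complex.Re R : C^o -> R).
Proof.
move=> z P /nbhs_ballP[e /= e0 eP]; apply/nbhsCP; exists e => // w wz.
by apply: eP; rewrite -ball_normE /= distrC (le_lt_trans _ wz)// -raddfB cnorm_Re.
Qed.

Lemma continuous_Im : continuous (@complex.Im R : C^o -> R).
Proof.
move=> z P /nbhs_ballP[e /= e0 eP]; apply/nbhsCP; exists e => // w wz.
by apply: eP; rewrite -ball_normE /= distrC (le_lt_trans _ wz)// -raddfB cnorm_Im.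
Qed.

Lemma continuous_line (z u : C) : continuous (fun t : R => z + t%:C%C * u : C^o).
Proof.
move=> t; apply/cvgCP => e e0.
have u0 : 0 < N u + 1 by rewrite ltr_pwDr// cnorm_ge0.
near=> s.
rewrite [X in N X](_ : _ = (s - t)%:C%C * u); last by rewrite rmorphB/=; ring.
rewrite cnormM cnorm_real.
rewrite (@le_lt_trans _ _ (`|s - t| * (N u + 1)))//.
  by rewrite ler_wpM2l// lerDl.
rewrite -ltr_pdivlMr// distrC; near: s.
by apply: (@cvgr_dist_lt _ R^o R^o) => //; rewrite divr_gt0.
Unshelve. all: by end_near. Qed.

End ComplexTopology.

Section ComplexIntegral.
Variable R : realType.
Local Notation C := (R[i]).
Local Notation N := (@cnorm R).
Local Notation mu := (@lebesgue_measure R).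
Implicit Types (g : R -> C) (a b : R).

(** The limits are two-sided even at the end points, so [g] is continuous as a function on the whole
    line at every point of the segment. *)
Definition cont_on a b g :=
  forall t, a <= t <= b -> (g s : C^o) @[s --> t] --> (g t : C^o).

Definition cint a b g : C :=
  (\int[mu]_(t in `[a, b]) complex.Re (g t))%:C%C +
  'i%C * (\int[mu]_(t in `[a, b]) complex.Im (g t))%:C%C.

Lemma fine_measure_itv a b : a <= b -> fine (mu `[a, b]) = b - a.
Proof.
move=> ab; have -> : mu `[a, b] = (b - a)%:E => //.
rewrite [LHS](lebesgue_measure_itv (Interval (BLeft a) (BRight b))).
rewrite /= lte_fin.
by case: ltgtP ab => // -> _; rewrite subrr.
Qed.

Lemma cont_integrable a b (h : R -> R) :
  (forall t, a <= t <= b -> h s @[s --> t] --> h t) ->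
  mu.-integrable `[a, b] (EFin \o h).
Proof.
move=> H; apply: continuous_compact_integrable; first exact: segment_compact.
by apply: continuous_in_subspaceT => t; rewrite inE/= in_itv/= => /H.
Qed.

Lemma cont_on_Re a b g : cont_on a b g ->
  mu.-integrable `[a, b] (EFin \o (fun t => complex.Re (g t))).
Proof.
move=> H; apply: cont_integrable => t /H.
by move/continuous_comp; apply; exact: continuous_Re.
Qed.

Lemma cont_on_Im a b g : cont_on a b g ->
  mu.-integrable `[a, b] (EFin \o (fun t => complex.Im (g t))).
Proof.
move=> H; apply: cont_integrable => t /H.
by move/continuous_comp; apply; exact: continuous_Im.
Qed.

Lemma cont_onZ a b c g : cont_on a b g -> cont_on a b (fun t => c * g t).
Proof. by move=> cg t tab; apply: cvgM; [exact: cvg_cst|exact: cg]. Qed.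

Lemma cont_on_cst a b c : cont_on a b (fun=> c).
Proof. by move=> t _; exact: cvg_cst. Qed.

Lemma cint_eq a b g h : (forall t, a <= t <= b -> g t = h t) ->
  cint a b g = cint a b h.
Proof.
move=> gh; congr (_%:C%C + _ * _%:C%C); apply: eq_Rintegral => t;
  by rewrite inE/= in_itv/= => /gh ->.
Qed.

Lemma cintD a b g h : cont_on a b g -> cont_on a b h ->
  cint a b (fun t => g t + h t) = cint a b g + cint a b h.
Proof.
move=> cg ch; rewrite /cint.
under eq_Rintegral do rewrite raddfD.
rewrite RintegralD//; [|exact: cont_on_Re..].
under [X in _ + _ * X%:C%C]eq_Rintegral do rewrite raddfD.
rewrite RintegralD//; [|exact: cont_on_Im..].
by rewrite !rmorphD/=; ring.
Qed.

Lemma cintZ a b c g : cont_on a b g ->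
  cint a b (fun t => c * g t) = c * cint a b g.
Proof.
move=> cg; rewrite /cint.
have iR := cont_on_Re cg; have iI := cont_on_Im cg.
have sc r (h : R -> R) : mu.-integrable `[a, b] (EFin \o h) ->
  mu.-integrable `[a, b] (EFin \o (fun t => r * h t)).
  by move=> ih; apply: (integrableZl _ r ih).
case: c cg => u v cg.
under eq_Rintegral => t _.
  rewrite (_ : complex.Re _ = u * complex.Re (g t) - v * complex.Im (g t)); last by case: (g t).
over.
rewrite RintegralB//; [|exact: sc..].
under [X in _ + _ * X%:C%C]eq_Rintegral => t _.
  rewrite (_ : complex.Im _ = u * complex.Im (g t) + v * complex.Re (g t)); last by case: (g t).
over.
rewrite RintegralD//; [|exact: sc..].
rewrite !RintegralZl//.
by apply/eqP; rewrite eq_complex /=; apply/andP; split; apply/eqP; ring.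
Qed.

Lemma cint_cst a b c : a <= b -> cint a b (fun=> c) = (b - a)%:C%C * c.
Proof.
move=> ab; rewrite /cint !Rintegral_cst// fine_measure_itv//.
case: c => u v /=.
by apply/eqP; rewrite eq_complex /=; apply/andP; split; apply/eqP; ring.
Qed.

Lemma cint_cat a b c g : a <= b -> b <= c -> cont_on a c g ->
  cint a c g = cint a b g + cint b c g.
Proof.
move=> ab bc cg.
have cat (h : R -> R) : mu.-integrable `[a, c] (EFin \o h) ->
  \int[mu]_(t in `[a, c]) h t =
  \int[mu]_(t in `[a, b]) h t + \int[mu]_(t in `[b, c]) h t.
  move=> ih.
  have := Rintegral_itvB ih (x := b); rewrite !bnd_simp => /(_ ab bc).
  rewrite Rintegral_itv_obnd_cbnd; last first.
    apply: integrableS ih => //; apply: subset_itv; rewrite ?bnd_simp//.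
  by move=> <-; rewrite addrC subrK.
rewrite /cint !cat//; [|exact: cont_on_Im|exact: cont_on_Re].
by rewrite !rmorphD/=; ring.
Qed.

(** Real and imaginary parts are bounded separately, hence the factor 2. The constant is not sharp,
    but only the order in [b - a] matters below. *)
Lemma cint_bound a b g M : a <= b -> cont_on a b g ->
  (forall t, a <= t <= b -> N (g t) <= M) ->
  N (cint a b g) <= 2 * M * (b - a).
Proof.
move=> ab cg gM.
have bd (h : R -> R) : mu.-integrable `[a, b] (EFin \o h) ->
  (forall t, a <= t <= b -> `|h t| <= M) ->
  `| \int[mu]_(t in `[a, b]) h t | <= M * (b - a).
  move=> ih hM; apply: le_trans (le_normr_Rintegral _ ih) _ => //.
  have -> : M * (b - a) = \int[mu]_(t in `[a, b]) M.
    by rewrite Rintegral_cst// fine_measure_itv.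
  apply: le_Rintegral => //.
  - exact: (integrable_norm ih).
  - by apply: (@cont_integrable a b (fun=> M)) => t _; exact: cvg_cst.
apply: (le_trans (cnorm_ReIm _)).
have -> : complex.Re (cint a b g) = \int[mu]_(t in `[a, b]) complex.Re (g t).
  by rewrite /cint /=; ring.
have -> : complex.Im (cint a b g) = \int[mu]_(t in `[a, b]) complex.Im (g t).
  by rewrite /cint /=; ring.
rewrite (_ : 2 * M * _ = M * (b - a) + M * (b - a)); last by ring.
apply: lerD; apply: bd.
- exact: cont_on_Re.
- by move=> t /gM; apply: le_trans; exact: cnorm_Re.
- exact: cont_on_Im.
- by move=> t /gM; apply: le_trans; exact: cnorm_Im.
Qed.

End ComplexIntegral.

(** * Bisection *)

Section Bisection.
Variable R : realType.
Implicit Types (F K : R -> R -> R -> R) (x y h u v e a : R).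

(** [F] is subadditive and [K] superadditive under quartering, so if the inequality fails on a
    square it fails on one of its quarters. The failing squares shrink to a point [(u, v)], where
    the local hypothesis contradicts failure. *)
Lemma square_bisection F K x0 y0 h0 : 0 < h0 ->
  let inside x y h := [/\ 0 < h, x0 <= x, x + h <= x0 + h0, y0 <= y & y + h <= y0 + h0] in
  let four G x y h := G x y (h / 2) + G (x + h / 2) y (h / 2) +
     G x (y + h / 2) (h / 2) + G (x + h / 2) (y + h / 2) (h / 2) in
  (forall x y h, inside x y h -> F x y h <= four F x y h) ->
  (forall x y h, inside x y h -> four K x y h <= K x y h) ->
  (forall u v, x0 <= u <= x0 + h0 -> y0 <= v <= y0 + h0 ->
     exists2 d, 0 < d & forall x y h, inside x y h -> h < d ->
       x <= u <= x + h -> y <= v <= y + h -> F x y h <= K x y h) ->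
  F x0 y0 h0 <= K x0 y0 h0.
Proof.
move=> h00 inside four subF supK loc; rewrite leNgt; apply/negP => FK0.
pose bad (s : R * R * R) := K s.1.1 s.1.2 s.2 < F s.1.1 s.1.2 s.2.
pose q1 (s : R * R * R) := (s.1.1, s.1.2, s.2 / 2).
pose q2 (s : R * R * R) := (s.1.1 + s.2 / 2, s.1.2, s.2 / 2).
pose q3 (s : R * R * R) := (s.1.1, s.1.2 + s.2 / 2, s.2 / 2).
pose q4 (s : R * R * R) := (s.1.1 + s.2 / 2, s.1.2 + s.2 / 2, s.2 / 2).
(* The fourth quarter is the default: when the first three are good, the two additivity hypotheses
   force it to be bad. *)
pose next s := if bad (q1 s) then q1 s else if bad (q2 s) then q2 s else
  if bad (q3 s) then q3 s else q4 s.
pose S n := iter n next (x0, y0, h0).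
have nextP s : inside s.1.1 s.1.2 s.2 -> bad s -> bad (next s).
  case: s => -[x y] h /= ins; rewrite /bad /next /= => b.
  have := subF _ _ _ ins; have := supK _ _ _ ins; rewrite /four => hK hF.
  case: ifPn => //; case: ifPn => //; case: ifPn => //.
  rewrite /bad /= -!leNgt; lra.
have nextE s : [/\ (next s).2 = s.2 / 2,
   (next s).1.1 = s.1.1 \/ (next s).1.1 = s.1.1 + s.2 / 2 &
   (next s).1.2 = s.1.2 \/ (next s).1.2 = s.1.2 + s.2 / 2].
  by rewrite /next; case: ifP => _; [|case: ifP => _; [|case: ifP => _]];
    split => //=; tauto.
have Sinv n : inside (S n).1.1 (S n).1.2 (S n).2 /\ bad (S n).
  elim: n => [|n [ins b]]; first by split => //; split => //=.
  split; last exact: nextP.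
  have [-> ex ey] := nextE (S n); case: ins => p1 p2 p3 p4 p5.
  by case: ex => ->; case: ey => ->; split; lra.
have Sh n : (S n).2 = h0 / 2 ^+ n.
  elim: n => [|n IH]; first by rewrite expr0 divr1.
  by have [-> _ _] := nextE (S n); rewrite IH exprS invfM mulrCA mulrC.
(* Serves both coordinates: the lower ends [X n] increase, the upper ends decrease, and the supremum
   of the lower ends lies in every interval. *)
have lim (X : nat -> R) : (forall n, X n.+1 = X n \/ X n.+1 = X n + (S n).2 / 2) ->
    exists u, forall n, X n <= u <= X n + (S n).2.
  move=> HX.
  have hp n : 0 < (S n).2 by case: (Sinv n) => -[].
  have mono : {homo X : m n / (m <= n)%N >-> m <= n}.
    apply: homo_leq => [//|? ? ?|n]; first exact: le_trans.
    by have := hp n; case: (HX n) => -> ?; lra.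
  have anti : {homo (fun n => - (X n + (S n).2)) : m n / (m <= n)%N >-> m <= n}.
    apply: homo_leq => [//|? ? ?|n]; first exact: le_trans.
    have [-> _ _] := nextE (S n).
    by have := hp n; case: (HX n) => -> ?; lra.
  have XX m n : X m <= X n + (S n).2.
    have h1 := mono m (maxn m n) (leq_maxl _ _).
    have h2 := anti n (maxn m n) (leq_maxr _ _).
    have h3 := hp (maxn m n); rewrite /= in h2.
    lra.
  exists (sup (range X)) => n; apply/andP; split.
    apply: ub_le_sup; last by exists n.
    by exists (X 0 + (S 0).2) => _ [m _ <-].
  apply: ge_sup; first by exists (X 0), 0.
  by move=> _ [m _ <-].
have [u uP] := lim (fun n => (S n).1.1) (fun n => let: And3 _ e _ := nextE (S n) in e).
have [v vP] := lim (fun n => (S n).1.2) (fun n => let: And3 _ _ e := nextE (S n) in e).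
have [d d0 dP] := loc u v (uP 0) (vP 0).
have [n hn] : exists n, (S n).2 < d.
  have /cvgrPdist_lt/(_ d d0)[n _ nP] : (fun n => h0 / 2 ^+ n) @ \oo --> (0 : R).
    rewrite -(mulr0 h0); apply: cvgM; first exact: cvg_cst.
    rewrite (_ : (fun _ => _) = (fun n => (2^-1) ^+ n)); last first.
      by apply/funext => n; rewrite exprVn.
    by apply: cvg_expr; rewrite ger0_norm// invf_lt1// ltr1n.
  exists n; rewrite Sh; have := nP n (leqnn _); rewrite /= sub0r normrN.
  by apply: le_lt_trans; exact: ler_norm.
have [ins b] := Sinv n.
by have := dP _ _ _ ins hn (uP n) (vP n); rewrite leNgt => /negP[].
Qed.

(** As [Num.sqrt] vanishes on negative numbers, this is the odd function sgn(t) sqrt|t|. Its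
    increments are additive over adjacent intervals, yet of order sqrt(h) on an interval of length h
    containing 0. *)
Definition ssqrt (t : R) := Num.sqrt t - Num.sqrt (- t).

Lemma ssqrt_mono (s t : R) : s <= t -> ssqrt s <= ssqrt t.
Proof.
move=> st; rewrite /ssqrt; apply: lerB; apply: ler_wsqrtr => //.
by rewrite lerN2.
Qed.

(** The increment is sqrt(x + h - a) + sqrt(a - x), and a sum of square roots dominates the root of
    the sum. Multiplying two such bounds, one per coordinate, gives the side [h] itself. *)
Lemma ssqrt_incr x h a : x <= a <= x + h ->
  Num.sqrt h <= ssqrt (x + h - a) - ssqrt (x - a).
Proof.
move=> /andP[xa ah]; rewrite /ssqrt.
have p0 : 0 <= x + h - a by lra.
have q0 : 0 <= a - x by lra.
rewrite (_ : - (x - a) = a - x); last by ring.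
rewrite [Num.sqrt (x - a)]ler0_sqrtr; last by lra.
rewrite [Num.sqrt (- _)]ler0_sqrtr; last by lra.
rewrite subr0 sub0r opprK.
rewrite -[leRHS]ger0_norm ?addr_ge0 ?sqrtr_ge0// -sqrtr_sqr.
apply: ler_wsqrtr; rewrite sqrrD !sqr_sqrtr//.
have := mulr_ge0 (sqrtr_ge0 (x + h - a)) (sqrtr_ge0 (a - x)); lra.
Qed.

End Bisection.

(** * Goursat's theorem *)

Section Goursat.
Variable R : realType.
Local Notation C := (R[i]).
Local Notation N := (@cnorm R).
Implicit Types (f g : C^o -> C^o) (x y h : R) (a z d : C).

(* Carathéodory's form of complex differentiability. *)
Definition cder f a d := exists q : C^o -> C^o,
  [/\ q w @[w --> cnbhs a] --> (d : C^o), q a = d &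
      forall w, f w = f a + q w * (w - a)].

Definition in_square x y h z :=
  x <= complex.Re z <= x + h /\ y <= complex.Im z <= y + h.

Definition on_edges x y h z := in_square x y h z /\
  [\/ complex.Im z = y, complex.Im z = y + h, complex.Re z = x | complex.Re z = x + h].

Definition ccont f z := f w @[w --> cnbhs z] --> (f z : C^o).

(** The counterclockwise contour integral along the boundary of the square with lower left corner x
    + iy and side h: bottom, top, right, left. *)
Definition sqI f x y h : C :=
  cint x (x + h) (fun t => f (t +i* y)%C) -
  cint x (x + h) (fun t => f (t +i* (y + h))%C) +
  'i * (cint y (y + h) (fun t => f ((x + h) +i* t)%C) -
        cint y (y + h) (fun t => f (x +i* t)%C)).

Definition edge_cont f x y h := forall z, on_edges x y h z -> ccont f z.

Lemma ccont_horizontal f x1 x2 y : (forall t, x1 <= t <= x2 -> ccont f (t +i* y)%C) ->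
  cont_on x1 x2 (fun t => f (t +i* y)%C).
Proof.
move=> H t tx.
have e s : (s +i* y)%C = (0 +i* y)%C + s%:C%C * 1.
  by apply/eqP; rewrite eq_complex /=; apply/andP; split; apply/eqP; ring.
have := H t tx; rewrite /ccont; under [in X in _ -> X]eq_fun do rewrite e.
rewrite e => fc; apply: (@cvg_comp _ _ _ (fun s : R => (0 +i* y)%C + s%:C%C * 1 : C^o) f _ _ _ _ fc).
exact: continuous_line.
Qed.

Lemma ccont_vertical f y1 y2 x : (forall t, y1 <= t <= y2 -> ccont f (x +i* t)%C) ->
  cont_on y1 y2 (fun t => f (x +i* t)%C).
Proof.
move=> H t tx.
have e s : (x +i* s)%C = (x +i* 0)%C + s%:C%C * 'i.
  by apply/eqP; rewrite eq_complex /=; apply/andP; split; apply/eqP; ring.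
have := H t tx; rewrite /ccont; under [in X in _ -> X]eq_fun do rewrite e.
rewrite e => fc; apply: (@cvg_comp _ _ _ (fun s : R => (x +i* 0)%C + s%:C%C * 'i : C^o) f _ _ _ _ fc).
exact: continuous_line.
Qed.

Lemma edge_cont4 f x y h : 0 <= h -> edge_cont f x y h ->
  [/\ cont_on x (x + h) (fun t => f (t +i* y)%C),
      cont_on x (x + h) (fun t => f (t +i* (y + h))%C),
      cont_on y (y + h) (fun t => f ((x + h) +i* t)%C) &
      cont_on y (y + h) (fun t => f (x +i* t)%C)].
Proof.
move=> h0 ec; split.
- apply: ccont_horizontal => t tx; apply: ec.
  by split; [rewrite /in_square /=; split => //; lra|apply: Or41].
- apply: ccont_horizontal => t tx; apply: ec.
  by split; [rewrite /in_square /=; split => //; lra|apply: Or42].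
- apply: ccont_vertical => t tx; apply: ec.
  by split; [rewrite /in_square /=; split => //; lra|apply: Or44].
- apply: ccont_vertical => t tx; apply: ec.
  by split; [rewrite /in_square /=; split => //; lra|apply: Or43].
Qed.

Lemma sqI_eq f g x y h : 0 <= h -> (forall z, on_edges x y h z -> f z = g z) ->
  sqI f x y h = sqI g x y h.
Proof.
move=> h0 fg; rewrite /sqI; congr (_ - _ + _ * (_ - _)); apply: cint_eq => t tx; apply: fg.
- by split; [rewrite /in_square /=; split => //; lra|apply: Or41].
- by split; [rewrite /in_square /=; split => //; lra|apply: Or42].
- by split; [rewrite /in_square /=; split => //; lra|apply: Or44].
- by split; [rewrite /in_square /=; split => //; lra|apply: Or43].
Qed.

Lemma sqID f g x y h : 0 <= h -> edge_cont f x y h -> edge_cont g x y h ->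
  sqI (fun z => f z + g z) x y h = sqI f x y h + sqI g x y h.
Proof.
move=> h0 /(edge_cont4 h0)[? ? ? ?] /(edge_cont4 h0)[? ? ? ?].
by rewrite /sqI !cintD//; ring.
Qed.

Lemma sqIZ c f x y h : 0 <= h -> edge_cont f x y h ->
  sqI (fun z => c * f z) x y h = c * sqI f x y h.
Proof.
move=> h0 /(edge_cont4 h0)[? ? ? ?].
by rewrite /sqI !cintZ//; ring.
Qed.

Lemma sqI_bound f x y h M : 0 <= h -> edge_cont f x y h ->
  (forall z, on_edges x y h z -> N (f z) <= M) -> N (sqI f x y h) <= 8 * M * h.
Proof.
move=> h0 /(edge_cont4 h0)[c1 c2 c3 c4] fM.
have bd u (g : R -> C) : cont_on u (u + h) g -> (forall t, u <= t <= u + h -> N (g t) <= M) ->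
    N (cint u (u + h) g) <= 2 * M * h.
  move=> cg gM; have -> : 2 * M * h = 2 * M * (u + h - u) by ring.
  by apply: cint_bound => //; lra.
have b1 : N (cint x (x + h) (fun t => f (t +i* y)%C)) <= 2 * M * h.
  apply: bd => // t tx; apply: fM.
  by split; [rewrite /in_square /=; split => //; lra|apply: Or41].
have b2 : N (cint x (x + h) (fun t => f (t +i* (y + h))%C)) <= 2 * M * h.
  apply: bd => // t tx; apply: fM.
  by split; [rewrite /in_square /=; split => //; lra|apply: Or42].
have b3 : N (cint y (y + h) (fun t => f ((x + h) +i* t)%C)) <= 2 * M * h.
  apply: bd => // t tx; apply: fM.
  by split; [rewrite /in_square /=; split => //; lra|apply: Or44].
have b4 : N (cint y (y + h) (fun t => f (x +i* t)%C)) <= 2 * M * h.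
  apply: bd => // t tx; apply: fM.
  by split; [rewrite /in_square /=; split => //; lra|apply: Or43].
rewrite /sqI (le_trans (cnormD _ _))//.
rewrite cnormM cnormi mul1r.
have t1 u v : N (u - v) <= N u + N v by rewrite (le_trans (cnormD _ _))// cnormN.
have := t1 (cint x (x + h) (fun t => f (t +i* y)%C)) (cint x (x + h) (fun t => f (t +i* (y + h))%C)).
have := t1 (cint y (y + h) (fun t => f ((x + h) +i* t)%C)) (cint y (y + h) (fun t => f (x +i* t)%C)).
lra.
Qed.

Lemma ccont_id z : ccont id z.
Proof. by move=> P. Qed.

Lemma ccont_affine z A B : ccont (fun w => A + B * w) z.
Proof. by apply: cvgD; [exact: cvg_cst|apply: cvgM; [exact: cvg_cst|exact: ccont_id]]. Qed.

(** Constants cancel between opposite edges. For the identity, opposite edges differ by the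
    constants ih and h, contributing -ih^2 and ih^2. *)
Lemma sqI_affine A B x y h : 0 <= h -> sqI (fun z => A + B * z) x y h = 0.
Proof.
move=> h0.
have ec (f : C^o -> C^o) : (forall z, ccont f z) -> edge_cont f x y h by move=> fc z _.
rewrite (@sqID (fun=> A) (fun z => B * z))//; first last.
- by apply: ec => z; apply: cvgM; [exact: cvg_cst|exact: ccont_id].
- by apply: ec => z; exact: cvg_cst.
rewrite (@sqIZ B id)//; last by apply: ec; exact: ccont_id.
have -> : sqI (fun=> A) x y h = 0 by rewrite /sqI; ring.
have [] := edge_cont4 h0 (ec _ ccont_id) => c1 c2 c3 c4.
have -> : sqI id x y h = 0; last by rewrite mulr0 addr0.
have hor : cint x (x + h) (fun t => (t +i* (y + h))%C) =
    cint x (x + h) (fun t => (t +i* y)%C) + h%:C%C * ('i * h%:C%C).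
  rewrite (@cint_eq _ _ _ _ (fun t => (t +i* y)%C + 'i * h%:C%C)); last first.
    by move=> t _; apply/eqP; rewrite eq_complex /=; apply/andP; split; apply/eqP; ring.
  rewrite (@cintD _ _ _ (fun t => (t +i* y)%C) (fun=> 'i * h%:C%C) c1 (@cont_on_cst _ _ _ _)).
  by rewrite cint_cst; [congr (_ + _%:C%C * _); ring|lra].
have ver : cint y (y + h) (fun t => ((x + h) +i* t)%C) =
    cint y (y + h) (fun t => (x +i* t)%C) + h%:C%C * h%:C%C.
  rewrite (@cint_eq _ _ _ _ (fun t => (x +i* t)%C + h%:C%C)); last first.
    by move=> t _; apply/eqP; rewrite eq_complex /=; apply/andP; split; apply/eqP; ring.
  rewrite (@cintD _ _ _ (fun t => (x +i* t)%C) (fun=> h%:C%C) c4 (@cont_on_cst _ _ _ _)).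
  by rewrite cint_cst; [congr (_ + _%:C%C * _); ring|lra].
by rewrite /sqI hor ver; ring.
Qed.

(** Each inner edge is traversed twice in opposite directions. *)
Lemma sqI_split f x y h : 0 <= h -> (forall z, in_square x y h z -> ccont f z) ->
  sqI f x y h = sqI f x y (h / 2) + sqI f (x + h / 2) y (h / 2) +
    sqI f x (y + h / 2) (h / 2) + sqI f (x + h / 2) (y + h / 2) (h / 2).
Proof.
move=> h0 fc.
have e u : u + h / 2 + h / 2 = u + h by lra.
have hor v : y <= v <= y + h -> cint x (x + h) (fun t => f (t +i* v)%C) =
    cint x (x + h / 2) (fun t => f (t +i* v)%C) + cint (x + h / 2) (x + h) (fun t => f (t +i* v)%C).
  move=> vy; apply: cint_cat; [lra|lra|].
  by apply: ccont_horizontal => t tx; apply: fc.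
have ver v : x <= v <= x + h -> cint y (y + h) (fun t => f (v +i* t)%C) =
    cint y (y + h / 2) (fun t => f (v +i* t)%C) + cint (y + h / 2) (y + h) (fun t => f (v +i* t)%C).
  move=> vy; apply: cint_cat; [lra|lra|].
  by apply: ccont_vertical => t tx; apply: fc.
rewrite /sqI !e !hor ?ver; [|lra..].
ring.
Qed.

Lemma cder_ccont f a d : cder f a d -> ccont f a.
Proof.
move=> [q [qd qa fq]]; rewrite /ccont.
under eq_fun do rewrite fq.
have : (f a + q w * (w - a) : C^o) @[w --> cnbhs a] --> (f a + d * (a - a) : C^o).
  apply: cvgD; first exact: cvg_cst.
  apply: cvgM; first exact: qd.
  by apply: cvgB; [exact: ccont_id|exact: cvg_cst].
by rewrite subrr mulr0 addr0.
Qed.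

Lemma in_square_dist x y h z w : 0 <= h -> in_square x y h z -> in_square x y h w ->
  N (w - z) <= 2 * h.
Proof.
move=> h0 [zx zy] [wx wy]; rewrite (le_trans (cnorm_ReIm _))//.
have : `|complex.Re (w - z)| <= h by rewrite raddfB /= ler_norml; lra.
have : `|complex.Im (w - z)| <= h by rewrite raddfB /= ler_norml; lra.
lra.
Qed.

(* At the puncture [a] continuity suffices: there the integral over a square of
   side [h] is [o(h)], which the second term of the control absorbs. *)
Theorem goursat f a x0 y0 h0 : 0 < h0 ->
  (forall z, in_square x0 y0 h0 z -> ccont f z) ->
  (forall z, in_square x0 y0 h0 z -> z != a -> exists d, cder f z d) ->
  sqI f x0 y0 h0 = 0.
Proof.
move=> h00 fc fd.
pose dx (c x h : R) := ssqrt (x + h - c) - ssqrt (x - c).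
have dx0 c x h : 0 <= h -> 0 <= dx c x h.
  by move=> ?; rewrite subr_ge0; apply: ssqrt_mono; lra.
(* Both terms are additive under quartering: the area, and the product of the [ssqrt] increments,
   which is at least [h] on a square containing [a]. *)
pose kappa x y h := h * h + dx (complex.Re a) x h * dx (complex.Im a) y h.
have k0 x y h : 0 <= h -> 0 <= kappa x y h.
  by move=> hh; rewrite addr_ge0 ?mulr_ge0 ?dx0.
have main e : 0 < e -> N (sqI f x0 y0 h0) <= 16 * e * kappa x0 y0 h0.
  move=> e0.
  apply: (@square_bisection _ (fun x y h => N (sqI f x y h))
     (fun x y h => 16 * e * kappa x y h)) => //.
  - move=> x y h [hh xx xh yy yh]; rewrite sqI_split; [|lra|]; last first.
      by move=> z [zx zy]; apply: fc; split; lra.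
    do 2 (apply: (le_trans (cnormD _ _)); rewrite lerD2r).
    exact: cnormD.
  - move=> x y h [hh xx xh yy yh]; rewrite -!mulrDr ler_wpM2l//; first lra.
    rewrite /kappa /dx.
    have e2 u : u + h / 2 + h / 2 = u + h by lra.
    rewrite !e2 -subr_ge0.
    set l := (X in 0 <= X); have -> : l = 0 by rewrite /l; field.
    by [].
  - move=> u v ux vy; pose z := (u +i* v)%C.
    have zin : in_square x0 y0 h0 z by [].
    have [za|za] := eqVneq z a.
      (* At the puncture the constant [f z] is subtracted, leaving an integrand of size at most [e]
         and an integral of size at most [8 * e * h]. The radius is halved because points of the
         square are only known to be within [2 * h] of each other. *)
      have /cvgCP/(_ e e0)/nbhsCP[r r0 rP] := fc z zin.
      exists (r / 2) => [|x y h [hh xx xh yy yh] hr uxh vyh]; first lra.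
      have zs : in_square x y h z by [].
      have ins w : in_square x y h w -> in_square x0 y0 h0 w.
        by move=> [? ?]; split; lra.
      have ec : edge_cont f x y h by move=> w [/ins ws _]; apply: fc.
      have ecc : edge_cont (fun=> - f z) x y h by move=> w _; exact: cvg_cst.
      have -> : sqI f x y h = sqI (fun w => f w + - f z) x y h.
        rewrite sqID//; last lra.
        have := @sqI_affine (- f z) 0 x y h (ltW hh).
        under [X in sqI X]eq_fun do rewrite mul0r addr0.
        by move=> ->; rewrite addr0.
      apply: (@le_trans _ _ (8 * e * h)).
        apply: sqI_bound; [lra| |].
        - by move=> w ws; apply: cvgD; [exact: ec|exact: ecc].
        - move=> w [ws _]; apply: ltW; apply: rP.
          by rewrite (le_lt_trans (in_square_dist _ zs ws))//; lra.
      rewrite /kappa mulrDr.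
      have : h <= dx (complex.Re a) x h * dx (complex.Im a) y h.
        rewrite -za -{1}(sqr_sqrtr (ltW hh)) expr2.
        by rewrite ler_pM ?sqrtr_ge0// ssqrt_incr.
      have := mulr_ge0 (ltW e0) (mulr_ge0 (ltW hh) (ltW hh)).
      move=> e1 e2; have := ler_wpM2l (ltW e0) e2.
      have := mulr_gt0 e0 hh.
      set A := dx _ _ _ * dx _ _ _.
      lra.
    have [d [q [qd qz fq]]] := fd z zin za.
    have /cvgCP/(_ e e0)/nbhsCP[r r0 rP] := qd.
    exists (r / 2) => [|x y h [hh xx xh yy yh] hr uxh vyh]; first lra.
    have zs : in_square x y h z by [].
    have ins w : in_square x y h w -> in_square x0 y0 h0 w.
      by move=> [? ?]; split; lra.
    have ec : edge_cont f x y h by move=> w [/ins ws _]; apply: fc.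
    (* Elsewhere the affine approximation of [f] at [z] is subtracted. The remainder
       [(q w - d) * (w - z)] is at most [e * (2 * h)], and the factor 8 of [sqI_bound] turns this
       into the 16 of the control. *)
    pose A : C := d * z - f z.
    have ecc : edge_cont (fun w => A + (- d) * w) x y h by move=> w _; exact: ccont_affine.
    have -> : sqI f x y h = sqI (fun w => f w + (A + (- d) * w)) x y h.
      by rewrite sqID ?sqI_affine ?addr0//; lra.
    apply: (@le_trans _ _ (8 * (e * (2 * h)) * h)).
      apply: sqI_bound; [lra| |].
      - by move=> w ws; apply: cvgD; [exact: ec|exact: ecc].
      - move=> w [ws _]; rewrite fq /A.
        rewrite [X in N X](_ : _ = (q w - d) * (w - z)); last by ring.
        have wz := in_square_dist (ltW hh) zs ws.
        rewrite cnormM ler_pM ?cnorm_ge0//.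
        by apply: ltW; apply: rP; rewrite (le_lt_trans wz)//; lra.
    rewrite /kappa mulrDr.
    have := mulr_ge0 (dx0 (complex.Re a) x h (ltW hh)) (dx0 (complex.Im a) y h (ltW hh)).
    move=> /(mulr_ge0 (ltW e0)); lra.
apply/eqP; rewrite -[_ == 0]negbK -cnorm_gt0 -leNgt.
apply/ler_addgt0Pr => e e0; rewrite add0r.
have k1 : 0 < kappa x0 y0 h0 + 1 by rewrite ltr_pwDr// k0// ltW.
have k2 : 0 < 16 * (kappa x0 y0 h0 + 1) by rewrite mulr_gt0.
apply: (le_trans (main (e / (16 * (kappa x0 y0 h0 + 1))) _)); first by rewrite divr_gt0.
have -> : 16 * (e / (16 * (kappa x0 y0 h0 + 1))) * kappa x0 y0 h0 =
    e * (kappa x0 y0 h0 / (kappa x0 y0 h0 + 1)) by field; rewrite lt0r_neq0.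
apply: ler_piMr; first exact: ltW.
by rewrite ler_pdivrMr// mul1r lerDl.
Qed.

End Goursat.

(** * Rules of complex differentiation *)

Section Calculus.
Variable R : realType.
Local Notation C := (R[i]).
Local Notation N := (@cnorm R).
Implicit Types (f g : C^o -> C^o) (a z d w : C).

Lemma near_cnbhsP (a : C) (P : C -> Prop) :
  (\forall w \near cnbhs a, P w) <-> exists2 e : R, 0 < e & forall w, N (w - a) < e -> P w.
Proof. exact: (@nbhsCP R a P). Qed.

Lemma near_near a (P : C -> Prop) : (\forall w \near cnbhs a, P w) ->
  \forall w \near cnbhs a, \forall v \near cnbhs w, P v.
Proof.
move=> /near_cnbhsP[e e0 eP]; apply/near_cnbhsP; exists (e / 2) => [|w wa]; first lra.
apply/near_cnbhsP; exists (e / 2) => [|v vw]; first lra.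
apply: eP; rewrite (_ : v - a = (v - w) + (w - a)); last by ring.
by rewrite (le_lt_trans (cnormD _ _))//; lra.
Qed.

Lemma near_self a (P : C -> Prop) : (\forall w \near cnbhs a, P w) -> P a.
Proof. by move=> /near_cnbhsP[e e0]; apply; rewrite subrr cnorm0. Qed.

(** Carathéodory's form suits products, inverses and compositions; this form suits local changes of
    the function and estimates of integrals. *)
Lemma cderP f a d : cder f a d <-> forall e : R, 0 < e ->
  \forall w \near cnbhs a, N (f w - f a - d * (w - a)) <= e * N (w - a).
Proof.
split=> [[q [qd qa fq]] e e0|H].
  have /cvgCP/(_ e e0) := qd; apply: filterS => w we.
  rewrite fq [X in N X](_ : _ = (q w - d) * (w - a)); last by ring.
  by rewrite cnormM ler_wpM2r ?cnorm_ge0// ltW.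
exists (fun w => if w == a then d else (f w - f a) / (w - a)); split.
- apply/cvgCP => e e0; have e2 : 0 < e / 2 by rewrite divr_gt0.
  apply: filterS (H _ e2) => w /=; case: eqVneq => [_ _|wa].
    by rewrite subrr cnorm0.
  have wa0 : w - a != 0 by rewrite subr_eq0.
  rewrite (_ : f w - f a - d * (w - a) = ((f w - f a) / (w - a) - d) * (w - a)); last first.
    by rewrite mulrBl divfK.
  rewrite cnormM ler_pM2r ?cnorm_gt0// => h; rewrite (le_lt_trans h)//; lra.
- by rewrite eqxx.
- move=> w; case: eqVneq => [->|wa]; first by rewrite subrr mulr0 addr0.
  by rewrite divfK ?subr_eq0// addrC subrK.
Qed.

Lemma cder_near f g a d : (\forall w \near cnbhs a, f w = g w) -> cder f a d -> cder g a d.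
Proof.
move=> fg /cderP fd; apply/cderP => e e0.
have fga : f a = g a by exact: (near_self fg).
by apply: filterS2 fg (fd e e0) => w; rewrite fga => ->.
Qed.

Lemma cder_local f (q : C^o -> C^o) a d : q w @[w --> cnbhs a] --> (d : C^o) ->
  (\forall w \near cnbhs a, f w = f a + q w * (w - a)) -> cder f a d.
Proof.
move=> qd fq; apply/cderP => e e0.
have /cvgCP/(_ e e0) qe := qd.
apply: filterS2 qe fq => w we ->.
rewrite [X in N X](_ : _ = (q w - d) * (w - a)); last by ring.
by rewrite cnormM ler_wpM2r ?cnorm_ge0// ltW.
Qed.

Lemma cder_cst c a : cder (fun=> c) a 0.
Proof.
by exists (fun=> 0); split => //; [exact: cvg_cst|move=> w; rewrite mul0r addr0].
Qed.

Lemma cder_id a : cder id a 1.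
Proof.
exists (fun=> 1); split => //; first exact: cvg_cst.
by move=> w; rewrite mul1r addrC subrK.
Qed.

Lemma cderD f g a d e : cder f a d -> cder g a e -> cder (fun w => f w + g w) a (d + e).
Proof.
move=> [p [pd pa fp]] [q [qe qa gq]]; exists (fun w => p w + q w); split.
- by apply: cvgD; [exact: pd|exact: qe].
- by rewrite pa qa.
- by move=> w; rewrite fp gq; ring.
Qed.

Lemma cderM f g a d e : cder f a d -> cder g a e ->
  cder (fun w => f w * g w) a (f a * e + d * g a).
Proof.
move=> fd [q [qe qa gq]]; have fc := cder_ccont fd; have [p [pd pa fp]] := fd.
exists (fun w => f w * q w + p w * g a); split.
- apply: cvgD; first by apply: cvgM; [exact: fc|exact: qe].
  by apply: cvgM; [exact: pd|exact: cvg_cst].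
- by rewrite pa qa.
- by move=> w; rewrite [g w]gq fp; ring.
Qed.

Lemma ccont_neq0 f a : ccont f a -> f a != 0 -> \forall w \near cnbhs a, f w != 0.
Proof.
move=> /cvgCP fc fa; have e0 : 0 < N (f a) by rewrite cnorm_gt0.
apply: filterS (fc _ e0) => w; apply: contraTneq => ->.
by rewrite sub0r cnormN ltxx.
Qed.

Lemma cderV f a d : cder f a d -> f a != 0 ->
  cder (fun w => (f w)^-1) a (- d / (f a * f a)).
Proof.
move=> fd fa; have fc := cder_ccont fd; have [p [pd pa fp]] := fd.
apply: (@cder_local _ (fun w => - p w / (f w * f a))).
  apply: cvgM; first by apply: cvgN; exact: pd.
  apply: cvgV; first by rewrite mulf_neq0.
  by apply: cvgM; [exact: fc|exact: cvg_cst].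
apply: filterS (ccont_neq0 fc fa) => w fw.
have -> : - p w / (f w * f a) * (w - a) = - (f w - f a) / (f w * f a).
  by rewrite fp; field; rewrite -fp fw fa.
by field; rewrite fw fa.
Qed.

Lemma cder_comp f g a d e : cder g a e -> cder f (g a) d ->
  cder (fun w => f (g w)) a (d * e).
Proof.
move=> ge [q [qd qa fq]]; have gc := cder_ccont ge; have [p [pe pa gp]] := ge.
exists (fun w => q (g w) * p w); split.
- apply: cvgM; last exact: pe.
  apply: (cvg_comp _ _ gc); exact: qd.
- by rewrite pa qa.
- by move=> w; rewrite fq [X in _ * (X - _)]gp; ring.
Qed.

(** With [derive_cder], this passes between [cder] and the derivability used in [holo_on] and
    [regular_at]; the direction is 1, so the increment [h] is itself complex. *)
Lemma cder_derive f a d : cder f a d -> derivable f a 1 /\ derive1 f a = d.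
Proof.
move=> /cderP H.
have fd : (h^-1 *: ((f \o shift (a : C^o)) (h *: (1 : C^o)) - f a)) @[h --> (0 : C^o)^'] --> (d : C^o).
  apply/cvgCP => e e0; have e2 : 0 < e / 2 by rewrite divr_gt0.
  have /near_cnbhsP[r r0 rP] := H _ e2.
  have : \forall h \near cnbhs 0, h != 0 ->
     N (h^-1 *: ((f \o shift (a : C^o)) (h *: (1 : C^o)) - f a) - d) < e.
    apply/near_cnbhsP; exists r => // h; rewrite subr0 => hr h0.
    have := rP (h + a); rewrite addrK => /(_ hr) hP.
    rewrite /= [h *: _]mulr1 -(ltr_pM2r (_ : 0 < N h)) ?cnorm_gt0// -cnormM.
    rewrite [X in N X](_ : _ = f (h + a) - f a - d * h); last first.
      by rewrite mulrBl /GRing.scale/= [_^-1 * _]mulrC divfK.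
    by rewrite (le_lt_trans hP)// ltr_pM2r ?cnorm_gt0//; lra.
  by [].
split; first by apply/cvg_ex; exists d.
by rewrite derive1E; apply/cvg_lim.
Qed.

Lemma derive_cder f a : derivable f a 1 -> cder f a (derive1 f a).
Proof.
rewrite derive1E /derive => fd; set d := lim _.
have {}fd : (h^-1 *: ((f \o shift (a : C^o)) (h *: (1 : C^o)) - f a)) @[h --> (0 : C^o)^'] --> (d : C^o) by exact: fd.
apply/cderP => e e0; move/cvgCP : fd => /(_ e e0) /nbhsCP[r r0 rP].
apply/near_cnbhsP; exists r => // w wa.
have [->|wa0] := eqVneq w a; first by rewrite !subrr mulr0 subr0 cnorm0 mulr0.
have := rP (w - a); rewrite subr0 => /(_ wa).
have h0 : w - a != 0 by rewrite subr_eq0.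
move=> /(_ h0); rewrite /= [(w - a) *: _]mulr1 subrK => /ltW hP.
rewrite (_ : _ - _ = ((w - a)^-1 *: (f w - f a) - d) * (w - a)); last first.
  by rewrite mulrBl /GRing.scale/= [_^-1 * _]mulrC divfK.
by rewrite cnormM ler_wpM2r ?cnorm_ge0.
Qed.

End Calculus.

(** * Cauchy's formula *)

Section Cauchy.
Variable R : realType.
Local Notation C := (R[i]).
Local Notation N := (@cnorm R).
Implicit Types (f g : C^o -> C^o) (a z d w : C).

Lemma cont_on_bounded (a b : R) (g : R -> C) : a <= b -> cont_on a b g ->
  exists M : R, forall t, a <= t <= b -> N (g t) <= M.
Proof.
move=> ab cg.
have cn : {within `[a, b], continuous (fun t => N (g t))}.
  apply: continuous_in_subspaceT => t; rewrite inE/= in_itv/= => /cg /cvgCP gt.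
  apply/cvgrPdist_lt => e e0; apply: filterS (gt e e0) => s.
  apply: le_lt_trans; rewrite distrC ler_norml.
  have := cnormD (g s) (g t - g s); have := cnormD (g t) (g s - g t).
  rewrite !subrKC [N (g t - g s)]cnormB; lra.
have [c _ cM] := EVT_max ab cn.
by exists (N (g c)) => t tab; apply: cM; rewrite in_itv.
Qed.

Lemma edge_bounded f x y h : 0 <= h -> edge_cont f x y h ->
  exists2 M : R, 0 < M & forall z, on_edges x y h z -> N (f z) <= M.
Proof.
move=> h0 /(edge_cont4 h0)[c1 c2 c3 c4].
have xh : x <= x + h by lra.
have yh : y <= y + h by lra.
have [M1 b1] := cont_on_bounded xh c1; have [M2 b2] := cont_on_bounded xh c2.
have [M3 b3] := cont_on_bounded yh c3; have [M4 b4] := cont_on_bounded yh c4.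
exists (`|M1| + `|M2| + `|M3| + `|M4| + 1).
  by rewrite ltr_pwDr// !addr_ge0.
have m1 := ler_norm M1; have m2 := ler_norm M2; have m3 := ler_norm M3; have m4 := ler_norm M4.
have n1 := normr_ge0 M1; have n2 := normr_ge0 M2; have n3 := normr_ge0 M3; have n4 := normr_ge0 M4.
move=> [u v] [[/= ux vy] [->|->|->|->]].
- by have := b1 u ux; lra.
- by have := b2 u ux; lra.
- by have := b4 v vy; lra.
- by have := b3 v vy; lra.
Qed.

(** Differentiation under the integral sign: a remainder quadratic in [w - a], uniformly on the
    edges, stays quadratic after integration. *)
Lemma cder_sqI (G : C -> C^o -> C^o) (G' : C^o -> C^o) a x y h (M : R) :
  0 <= h -> (\forall w \near cnbhs a, edge_cont (G w) x y h) -> edge_cont G' x y h ->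
  (\forall w \near cnbhs a, forall z, on_edges x y h z ->
     N (G w z - G a z - (w - a) * G' z) <= M * N (w - a) ^+ 2) ->
  cder (fun w => sqI (G w) x y h) a (sqI G' x y h).
Proof.
move=> h0 Gc G'c GM; apply/cderP => e e0.
have Gac := near_self Gc.
have M0 : 0 < 8 * h * `|M| + 1 by rewrite ltr_pwDr// !mulr_ge0.
(* [M] may be negative, hence its absolute value; the summand 1 keeps the denominator positive. *)
have sm : \forall w \near cnbhs a, N (w - a) < e / (8 * h * `|M| + 1).
  by apply/near_cnbhsP; exists (e / (8 * h * `|M| + 1)) => //; rewrite divr_gt0.
apply: filterS3 Gc GM sm => w Gwc GwM wa.
have c1 : edge_cont (fun z => -1 * G a z) x y h.
  by move=> z zb; apply: cvgM; [exact: cvg_cst|exact: Gac].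
have c2 : edge_cont (fun z => - (w - a) * G' z) x y h.
  by move=> z zb; apply: cvgM; [exact: cvg_cst|exact: G'c].
have c3 : edge_cont (fun z => -1 * G a z + - (w - a) * G' z) x y h.
  by move=> z zb; apply: cvgD; [exact: c1|exact: c2].
have -> : sqI (G w) x y h - sqI (G a) x y h - sqI G' x y h * (w - a) =
    sqI (fun z => G w z + (-1 * G a z + - (w - a) * G' z)) x y h.
  by rewrite (sqID h0 Gwc c3) (sqID h0 c1 c2) (sqIZ _ h0 Gac) (sqIZ _ h0 G'c); ring.
apply: (@le_trans _ _ (8 * (M * N (w - a) ^+ 2) * h)).
  apply: sqI_bound; first exact: h0.
    by move=> z zb; apply: cvgD; [exact: Gwc|exact: c3].
  by move=> z zb; have := GwM z zb; rewrite [X in N X <= _ -> _](_ : _ = G w z + (-1 * G a z + - (w - a) * G' z)); last by ring.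
have n0 := cnorm_ge0 (w - a).
rewrite (_ : 8 * _ * h = (8 * h * M * N (w - a)) * N (w - a)); last by ring.
apply: ler_wpM2r => //.
move: wa; rewrite ltr_pdivlMr// => /ltW; apply: le_trans.
rewrite mulrC ler_wpM2l// (@le_trans _ _ (8 * h * `|M|)) ?lerDl//.
by rewrite ler_wpM2l ?mulr_ge0// ler_norm.
Qed.

Definition edge_dist (r : R) z := on_edges (- r) (- r) (2 * r) z.

(** One coordinate of a boundary point [z] has absolute value [r], so [N z] is at least [r]. This
    keeps the Cauchy kernels bounded for [w] near the centre. *)
Lemma edge_far (r : R) z w : 0 < r -> edge_dist r z -> N w < r / 2 -> r / 2 <= N (z - w).
Proof.
move=> r0 [_ H] wr.
have : r <= N z.
  have hR := cnorm_Re z; have hI := cnorm_Im z; move: hR hI.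
  by rewrite !ler_norml => /andP[a1 a2] /andP[b1 b2]; case: H => H; rewrite H in a1 a2 b1 b2; lra.
have := cnormD (z - w) w; rewrite subrK; lra.
Qed.

Section Kernel.
Variables (r : R) (phi : C^o -> C^o).
Hypotheses (r0 : 0 < r) (pc : edge_cont phi (- r) (- r) (2 * r)).

Lemma kernel_cont w k : N w < r / 2 ->
  edge_cont (fun z => phi z * ((z - w)^-1) ^+ k) (- r) (- r) (2 * r).
Proof.
move=> wr z zb; apply: cvgM; first exact: pc.
elim: k => [|k IH]; first by under eq_fun do rewrite expr0; exact: cvg_cst.
under eq_fun do rewrite exprS; rewrite exprS; apply: cvgM; last exact: IH.
apply: cvgV.
  by rewrite -cnorm_gt0 (lt_le_trans _ (edge_far r0 zb wr))// divr_gt0.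
by apply: cvgB; [exact: ccont_id|exact: cvg_cst].
Qed.

(** The Cauchy integral with kernel 1/(z - w)^k, without the factor 1/(2 pi i): the case of density
    1 serves as normalisation instead. *)
Definition cauchy_integral k w := sqI (fun z => phi z * ((z - w)^-1) ^+ k) (- r) (- r) (2 * r).

(** The kernels of orders 1 and 2 suffice: the first differentiation represents [f'], the second
    shows that [f'] is differentiable. *)
Lemma cder_cauchy_integral k a : (k <= 1)%N -> N a < r / 2 ->
  cder (cauchy_integral k.+1) a (sqI (fun z => k.+1%:R * (phi z * ((z - a)^-1) ^+ k.+2)) (- r) (- r) (2 * r)).
Proof.
have h0 : 0 <= 2 * r by rewrite mulr_ge0// ltW.
move=> k1 ar.
have [Mp Mp0 phiM] := edge_bounded h0 pc.
have nearr : \forall w \near cnbhs a, N w < r / 2.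
  apply/near_cnbhsP; exists (r / 2 - N a) => [|w wa]; first by rewrite subr_gt0.
  by have := cnormD (w - a) a; rewrite subrK; lra.
(* With u = z - a and v = z - w, the kernel remainder divided by (u - v)^2 is 1/(u^2 v) for k = 0
   and 1/(u^2 v^2) + 2/(u^3 v) for k = 1. Both are at most three times (r/2)^-(k+3). *)
pose K : R := Mp * (3 * (r / 2)^-1 ^+ k.+3).
apply: (@cder_sqI (fun w z => phi z * ((z - w)^-1) ^+ k.+1) _ a _ _ _ K h0).
- by apply: filterS nearr => w wr; exact: kernel_cont.
- by move=> z zb; apply: cvgM; [exact: cvg_cst|exact: kernel_cont].
apply: filterS nearr => w wr z zb.
have := edge_far r0 zb wr; have := edge_far r0 zb ar.
have -> : w - a = (z - a) - (z - w) by ring.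
move: (z - a) (z - w) => u v ur vr.
have rr : 0 < r / 2 by rewrite divr_gt0.
have u0 : u != 0 by rewrite -cnorm_gt0 (lt_le_trans rr).
have v0 : v != 0 by rewrite -cnorm_gt0 (lt_le_trans rr).
have ui : N u^-1 <= (r / 2)^-1.
  by rewrite cnormV lef_pV2 ?posrE ?cnorm_gt0.
have vi : N v^-1 <= (r / 2)^-1.
  by rewrite cnormV lef_pV2 ?posrE ?cnorm_gt0.
have ui0 := cnorm_ge0 u^-1; have vi0 := cnorm_ge0 v^-1.
rewrite (_ : _ - _ - _ = phi z * (v^-1 ^+ k.+1 - u^-1 ^+ k.+1 - (u - v) * (k.+1%:R * u^-1 ^+ k.+2))); last by ring.
rewrite cnormM /K -mulrA; apply: ler_pM; rewrite ?cnorm_ge0//; first exact: phiM.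
case: k k1 {K} => [|[|//]] _.
  rewrite (_ : _ - _ - _ = u^-1 ^+ 2 * v^-1 * (u - v) ^+ 2); last by field; rewrite u0 v0.
  rewrite expr2 !cnormM [N (u - v) ^+ 2]expr2 ler_wpM2r ?mulr_ge0 ?cnorm_ge0//.
  rewrite !exprS expr0 mulr1.
  set s := (r / 2)^-1 in ui vi *.
  have s0 : 0 <= s by rewrite (le_trans _ ui).
  have := ler_pM (mulr_ge0 ui0 ui0) vi0 (ler_pM ui0 ui0 ui ui) vi.
  have := mulr_ge0 (mulr_ge0 s0 s0) s0; lra.
rewrite (_ : _ - _ - _ = (u^-1 ^+ 2 * v^-1 ^+ 2 + 2 * (u^-1 ^+ 3 * v^-1)) * (u - v) ^+ 2); last by field; rewrite u0 v0.
rewrite cnormM (_ : N ((u - v) ^+ 2) = N (u - v) ^+ 2); last by rewrite expr2 cnormM.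
apply: ler_wpM2r; first by rewrite exprn_ge0 ?cnorm_ge0.
apply: (le_trans (cnormD _ _)).
have n2 : N 2 = 2.
  have -> : (2 : C) = (2 : R)%:C%C by rewrite rmorph_nat.
  by rewrite cnorm_real ger0_norm.
rewrite !exprS !expr0 !mulr1 !cnormM n2.
set s := (r / 2)^-1 in ui vi *.
have uu := ler_pM ui0 ui0 ui ui.
have e1 := ler_pM (mulr_ge0 ui0 ui0) (mulr_ge0 vi0 vi0) uu (ler_pM vi0 vi0 vi vi).
have e2 := ler_pM (mulr_ge0 ui0 (mulr_ge0 ui0 ui0)) vi0 (ler_pM ui0 (mulr_ge0 ui0 ui0) ui uu) vi.
lra.
Qed.

End Kernel.

Lemma cint_Re_ge (a b c : R) (g : R -> C) : a <= b -> cont_on a b g ->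
  (forall t, a <= t <= b -> c <= complex.Re (g t)) -> c * (b - a) <= complex.Re (cint a b g).
Proof.
move=> ab cg gc.
have -> : complex.Re (cint a b g) = \int[@lebesgue_measure R]_(t in `[a, b]) complex.Re (g t).
  by rewrite /cint /=; ring.
have -> : c * (b - a) = \int[@lebesgue_measure R]_(t in `[a, b]) c.
  by rewrite Rintegral_cst// fine_measure_itv.
apply: le_Rintegral => //.
- by apply: (@cont_integrable _ a b (fun=> c)) => t _; exact: cvg_cst.
- exact: cont_on_Re.
Qed.

End Cauchy.

Section CauchyFormula.
Variable R : realType.
Local Notation C := (R[i]).
Local Notation N := (@cnorm R).
Implicit Types (f g : C^o -> C^o) (a z d w : C).

Lemma edge_cont_inv (r : R) w : 0 < r -> N w < r / 2 ->
  edge_cont (fun z => (z - w)^-1 : C^o) (- r) (- r) (2 * r).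
Proof.
move=> r0 wr z zb; apply: cvgV.
  by rewrite -cnorm_gt0 (lt_le_trans _ (edge_far r0 zb wr))// divr_gt0.
by apply: cvgB; [exact: ccont_id|exact: cvg_cst].
Qed.

(** The imaginary part is positive, since each of the four edges contributes the integral of r/(t^2
    + r^2) over [-r, r]. *)
Lemma winding_neq0 (r : R) : 0 < r -> cauchy_integral r (fun=> 1) 1 0 != 0.
Proof.
move=> r0; have h0 : 0 <= 2 * r by rewrite mulr_ge0// ltW.
rewrite /cauchy_integral (@sqI_eq _ _ (fun z => z^-1))//; last first.
  by move=> z _; rewrite subr0 expr1 mul1r.
have ec : edge_cont (fun z : C^o => z^-1 : C^o) (- r) (- r) (2 * r).
  have N0 : N 0 < r / 2 by rewrite cnorm0 divr_gt0.
  by have := edge_cont_inv r0 N0; under eq_fun do rewrite subr0.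
have [c1 c2 c3 c4] := edge_cont4 h0 ec.
apply/eqP => /(congr1 (@complex.Im R)).
have e : - r + 2 * r = r by ring.
move: c1 c2 c3 c4; rewrite /sqI !e.
set g1 := fun t => (t +i* - r)%C^-1; set g2 := fun t => (t +i* r)%C^-1.
set g3 := fun t => (r +i* t)%C^-1; set g4 := fun t => (- r +i* t)%C^-1.
move=> c1 c2 c3 c4.
have lb c (g : R -> C) : cont_on (- r) r g ->
   (forall t, complex.Re (c * g t) = r / (t ^+ 2 + r ^+ 2)) ->
   0 < complex.Re (c * cint (- r) r g).
  move=> cg gE; rewrite -cintZ//.
  (* For |t| <= r the integrand r/(t^2 + r^2) is at least 1/(2r). *)
  apply: (@lt_le_trans _ _ ((2 * r)^-1 * (r - - r))).
    by rewrite mulr_gt0 ?invr_gt0 ?mulr_gt0//; lra.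
  apply: cint_Re_ge; [lra|exact: cont_onZ|].
  move=> t tr; rewrite gE.
  have t2 : t ^+ 2 <= r ^+ 2 by rewrite -subr_ge0 subr_sqr mulr_ge0//; lra.
  have d0 : 0 < t ^+ 2 + r ^+ 2 by rewrite ltr_wpDl ?sqr_ge0// exprn_gt0.
  rewrite ler_pdivlMr// mulrC ler_pdivrMr ?mulr_gt0//.
  by rewrite (_ : r * (2 * r) = r ^+ 2 + r ^+ 2) ?lerD2r//; ring.
have p1 : 0 < complex.Re (- 'i * cint (- r) r g1).
  apply: lb => // t; rewrite /g1 /=.
  by rewrite sqrrN; ring.
have p2 : 0 < complex.Re ('i * cint (- r) r g2).
  by apply: lb => // t; rewrite /g2 /=; ring.
have p3 : 0 < complex.Re (1 * cint (- r) r g3).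
  apply: lb => // t; rewrite /g3 /=.
  by rewrite [t ^+ 2 + _]addrC; ring.
have p4 : 0 < complex.Re (-1 * cint (- r) r g4).
  apply: lb => // t; rewrite /g4 /=.
  by rewrite sqrrN [t ^+ 2 + _]addrC; ring.
move: p1 p2 p3 p4; move: (cint _ _ g1) (cint _ _ g2) (cint _ _ g3) (cint _ _ g4).
move=> [x1 y1] [x2 y2] [x3 y3] [x4 y4] /=; lra.
Qed.

Lemma small_in_square (r : R) a : 0 < r -> N a < r / 2 -> in_square (- r) (- r) (2 * r) a.
Proof.
move=> r0 ar; have hR := cnorm_Re a; have hI := cnorm_Im a; move: hR hI.
by rewrite !ler_norml => /andP[? ?] /andP[? ?]; split; lra.
Qed.

(** The difference quotient [q] of [f] at [a] is continuous at [a] and differentiable elsewhere, so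
    [goursat] with puncture [a] makes its integral vanish; on the edges it equals (f(z) - f(a))/(z -
    a). *)
Lemma cauchy_formula f (r : R) a : 0 < r ->
  (forall z, in_square (- r) (- r) (2 * r) z -> exists d, cder f z d) ->
  N a < r / 2 -> cauchy_integral r f 1 a = f a * cauchy_integral r (fun=> 1) 1 a.
Proof.
move=> r0 fd ar; have h0 : 0 <= 2 * r by rewrite mulr_ge0// ltW.
have fc z : in_square (- r) (- r) (2 * r) z -> ccont f z.
  by move=> /fd[d /cder_ccont].
have [d [q [qd qa fq]]] := fd a (small_in_square r0 ar).
have qder z : in_square (- r) (- r) (2 * r) z -> z != a -> exists d', cder q z d'.
  move=> zs za; have [e fe] := fd z zs.
  have za0 : z - a != 0 by rewrite subr_eq0.
  have ida : cder (fun w => w - a) z (1 + 0) by apply: cderD; [exact: cder_id|exact: cder_cst].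
  have fa : cder (fun w => f w - f a) z (e + 0) by apply: cderD; [exact: fe|exact: cder_cst].
  have H := cderM fa (cderV ida za0).
  eexists; apply: (cder_near _ H).
  have : \forall w \near cnbhs z, w - a != 0 by exact: (ccont_neq0 (cder_ccont ida) za0).
  by apply: filterS => w wa; rewrite fq addrC addKr mulfK.
have qc z : in_square (- r) (- r) (2 * r) z -> ccont q z.
  move=> zs; have [->|za] := eqVneq z a; first by rewrite /ccont qa; exact: qd.
  by have [d' /cder_ccont] := qder z zs za.
have hh : 0 < 2 * r by rewrite mulr_gt0.
have q0 := goursat hh qc qder.
have one : edge_cont (fun=> 1 : C^o) (- r) (- r) (2 * r) by move=> z _; exact: cvg_cst.
have fe : edge_cont f (- r) (- r) (2 * r) by move=> z [zs _]; exact: fc.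
have k1 := @kernel_cont _ _ _ r0 one a 1 ar.
have k2 := @kernel_cont _ _ _ r0 fe a 1 ar.
have : sqI q (- r) (- r) (2 * r) = cauchy_integral r f 1 a + (- f a) * cauchy_integral r (fun=> 1) 1 a.
  have k3 : edge_cont (fun z => - f a * (1 * ((z - a)^-1) ^+ 1) : C^o) (- r) (- r) (2 * r).
    by move=> z zb; apply: cvgM; [exact: cvg_cst|exact: k1].
  rewrite /cauchy_integral -(sqIZ (- f a) h0 k1) -(sqID h0 k2 k3).
  apply: (sqI_eq h0) => z zb.
  have za : z - a != 0.
    by rewrite -cnorm_gt0 (lt_le_trans _ (edge_far r0 zb ar))// divr_gt0.
  by rewrite fq expr1; field.
by rewrite q0 mulNr => /esym/eqP; rewrite subr_eq0 => /eqP.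
Qed.

Lemma cder_cauchy_integral1 f (r : R) a : 0 < r -> edge_cont f (- r) (- r) (2 * r) -> N a < r / 2 ->
  cder (cauchy_integral r f 1) a (cauchy_integral r f 2 a).
Proof.
move=> r0 fe ar; have := cder_cauchy_integral r0 fe (leq0n 1) ar.
have h0 : 0 <= 2 * r by rewrite mulr_ge0// ltW.
by rewrite (sqIZ _ h0 (@kernel_cont _ _ _ r0 fe a 2 ar)) mul1r.
Qed.

Definition holomorphic_near f z := \forall w \near cnbhs z, exists d, cder f w d.

(** Near 0, [f] is the quotient of its Cauchy integral by that of 1. The denominator [W] is not
    known to be constant, so the quotient rule expresses [f'] through integrals with kernels of
    orders 1 and 2, which are again differentiable. *)
Theorem holomorphic_derive1 f : holomorphic_near f 0 -> holomorphic_near (derive1 f) 0.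
Proof.
(* Points of the square have norm at most 2r = r0/2, inside the disc where [f] is differentiable. *)
move=> /near_cnbhsP[r0 r00 r0P]; pose r := r0 / 4.
have r_gt0 : 0 < r by rewrite divr_gt0.
have fd z : in_square (- r) (- r) (2 * r) z -> exists d, cder f z d.
  move=> [zx zy]; apply: r0P; rewrite subr0 (le_lt_trans (cnorm_ReIm _))//.
  have : `|complex.Re z| <= r by rewrite ler_norml; lra.
  have : `|complex.Im z| <= r by rewrite ler_norml; lra.
  rewrite /r in r_gt0 *; lra.
have one : edge_cont (fun=> 1 : C^o) (- r) (- r) (2 * r) by move=> z _; exact: cvg_cst.
have fe : edge_cont f (- r) (- r) (2 * r) by move=> z [/fd[d /cder_ccont]].
pose W := cauchy_integral r (fun=> 1) 1.
have near_r w : N w < r / 2 -> \forall v \near cnbhs w, N v < r / 2.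
  move=> wr; apply/near_cnbhsP; exists (r / 2 - N w) => [|v vw]; first lra.
  by have := cnormD (v - w) w; rewrite subrK; lra.
have N0 : N 0 < r / 2 by rewrite cnorm0 divr_gt0.
have Wnear : \forall w \near cnbhs 0, N w < r / 2 /\ W w != 0.
  have W0 := ccont_neq0 (cder_ccont (cder_cauchy_integral1 r_gt0 one N0)) (winding_neq0 r_gt0).
  by apply: filterS2 (near_r _ N0) W0.
have fder : \forall w \near cnbhs 0,
    derive1 f w = cauchy_integral r f 1 w * (- cauchy_integral r (fun=> 1) 2 w / (W w * W w)) + cauchy_integral r f 2 w * (W w)^-1.
  apply: filterS (near_near Wnear) => w nw.
  have [wr Ww] := near_self nw.
  have H := cderM (cder_cauchy_integral1 r_gt0 fe wr) (cderV (cder_cauchy_integral1 r_gt0 one wr) Ww).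
  refine (proj2 (cder_derive (cder_near _ H))).
  apply: filterS nw => v [vr Wv].
  by rewrite (cauchy_formula r_gt0 fd vr) mulfK.
apply: filterS2 (near_near fder) Wnear => w nw [wr Ww].
have d1 := cder_cauchy_integral1 r_gt0 fe wr; have dW := cder_cauchy_integral1 r_gt0 one wr.
have [d2 D2] : exists d, cder (cauchy_integral r f 2) w d by eexists; exact: (cder_cauchy_integral r_gt0 fe (leqnn 1) wr).
have [e2 E2] : exists d, cder (cauchy_integral r (fun=> 1) 2) w d by eexists; exact: (cder_cauchy_integral r_gt0 one (leqnn 1) wr).
have WW : W w * W w != 0 by rewrite mulf_neq0.
have H := cderD (cderM d1 (cderM (cderM (cder_cst (-1) w) E2) (cderV (cderM dW dW) WW))) (cderM D2 (cderV dW Ww)).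
eexists; apply: (cder_near _ H).
by apply: filterS nw => v ->; rewrite mulN1r.
Qed.

End CauchyFormula.

(** * Taylor coefficients *)

Section Peano.
Variable R : realType.
Local Notation C := (R[i]).
Local Notation N := (@cnorm R).
Implicit Types (f g : C^o -> C^o) (a z d w : C).

Lemma is_derive_Re_ray f z d (t : R) : cder f (t%:C%C * z) d ->
  is_derive t 1 (fun s : R => complex.Re (f (s%:C%C * z))) (complex.Re (d * z)).
Proof.
move=> [q [qd qa fq]].
have H : (h^-1 *: (((fun s : R => complex.Re (f (s%:C%C * z))) \o shift t) (h *: (1 : R)) -
   complex.Re (f (t%:C%C * z)))) @[h --> (0 : R)^'] --> complex.Re (d * z).
  apply: (@cvg_trans _ ((fun h : R => complex.Re (q ((h + t)%:C%C * z) * z)) @ (0 : R)^')).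
    apply: near_eq_cvg; near=> h.
    rewrite /= [h *: _]mulr1 -raddfB fq [f _ + _]addrC addrK.
    have h0 : h != 0 by near: h; exact: nbhs_dnbhs_neq.
    have -> : q ((h + t)%:C%C * z) * ((h + t)%:C%C * z - t%:C%C * z) =
       h%:C%C * (q ((h + t)%:C%C * z) * z) by rewrite rmorphD/=; ring.
    case: (q _ * z) => x y /=.
    by rewrite mul0r subr0 /GRing.scale/= mulKf.
  apply: cvg_within_filter.
  have cq : (q ((h + t)%:C%C * z) * z : C^o) @[h --> (0 : R)] --> (d * z : C^o).
    apply: cvgM; last exact: cvg_cst.
    have e : (fun h : R => (h + t)%:C%C * z : C^o) = (fun h : R => t%:C%C * z + h%:C%C * z : C^o).
      by apply/funext => h; rewrite rmorphD/=; ring.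
    have := @continuous_line R (t%:C%C * z) z 0.
    rewrite /continuous_at /= mul0r addr0 -e => c1.
    by apply: (cvg_comp _ _ c1); exact: qd.
  by apply: (cvg_comp _ _ cq); exact: continuous_Re.
apply: DeriveDef; first by apply/cvg_ex; eexists; exact: H.
by rewrite /derive; apply/cvg_lim => //; exact: H.
Unshelve. all: by end_near. Qed.

(** The mean value theorem concerns real functions of a real variable, so it is applied to the real
    part of [f] along the segment from 0 to [z]. *)
Lemma Re_mean_value f z (M : R) :
  (forall t : R, 0 <= t <= 1 -> exists2 d, cder f (t%:C%C * z) d & N d <= M) ->
  `|complex.Re (f z - f 0)| <= M * N z.
Proof.
move=> H.
pose phi (s : R) := complex.Re (f (s%:C%C * z)).
have /choice[df dfP] : forall t : R, exists y : R, 0 <= t <= 1 ->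
    is_derive t 1 phi y /\ `|y| <= M * N z.
  move=> t.
  (* Outside the unit interval the value 0 is a placeholder, making the choice of derivatives
     total. *)
  have [t01|t01] := boolP (0 <= t <= 1); last by exists 0.
  have [d fd dM] := H t t01; exists (complex.Re (d * z)) => _; split.
    exact: is_derive_Re_ray.
  by rewrite (le_trans (cnorm_Re _))// cnormM ler_wpM2r ?cnorm_ge0.
have [c c01 cE] : exists2 c, c \in `[0, 1]%R & phi 1 - phi 0 = df c * (1 - 0).
  apply: MVT_segment => //.
    by move=> x; rewrite in_itv/= => /andP[x0 x1]; case: (dfP x) => //; rewrite !ltW.
  apply: derivable_within_continuous => x; rewrite in_itv/= => x01.
  by have [[]] := dfP x x01.
move: cE; rewrite /phi rmorph1 rmorph0 mul1r mul0r subr0 mulr1 raddfB => ->.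
by move: c01; rewrite in_itv/= => /dfP[].
Qed.

Lemma mean_value f z (M : R) :
  (forall t : R, 0 <= t <= 1 -> exists2 d, cder f (t%:C%C * z) d & N d <= M) ->
  N (f z - f 0) <= 2 * (M * N z).
Proof.
move=> H; rewrite (le_trans (cnorm_ReIm _))//.
have hR := Re_mean_value H.
(* The imaginary part of [f] is the real part of -i f. *)
have /Re_mean_value hI : forall t : R, 0 <= t <= 1 ->
    exists2 d, cder (fun w => - 'i * f w) (t%:C%C * z) d & N d <= M.
  move=> t /H[d fd dM]; eexists; first by apply: (cderM (cder_cst (- 'i) _) fd).
  by rewrite mul0r addr0 cnormM cnormN cnormi mul1r.
have e : complex.Re (- 'i * f z - - 'i * f 0) = complex.Im (f z - f 0).
  by rewrite -mulrBr; case: (f z - f 0) => x y /=; ring.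
rewrite e in hI; lra.
Qed.

Lemma holomorphic_near_ccont f a : holomorphic_near f a -> ccont f a.
Proof. by move=> /near_self[d /cder_ccont]. Qed.

Lemma cder_derive1 f a : (exists d, cder f a d) -> cder f a (derive1 f a).
Proof. by move=> [d fd]; have [_ ->] := cder_derive fd. Qed.

(** Induction on [n]: the derivatives are holomorphic near 0 and agree to one order less, so they
    differ by at most (e/2)|w|^n on the segment from 0 to z. The mean value inequality adds a factor
    |z|, and its constant 2 absorbs the half. *)
Theorem peano_order n f g : holomorphic_near f 0 -> holomorphic_near g 0 ->
  (forall k, (k <= n)%N -> derive1n k f 0 = derive1n k g 0) ->
  forall e : R, 0 < e -> \forall z \near cnbhs 0, N (f z - g z) <= e * N z ^+ n.
Proof.
elim: n f g => [|n IH] f g hf hg fg e e0.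
  have fg0 : f 0 = g 0 by have := fg 0 (leqnn 0).
  have e2 : 0 < e / 2 by rewrite divr_gt0.
  have /cvgCP/(_ _ e2) cf := holomorphic_near_ccont hf.
  have /cvgCP/(_ _ e2) cg := holomorphic_near_ccont hg.
  apply: filterS2 cf cg => z zf zg; rewrite expr0 mulr1.
  rewrite (_ : f z - g z = (f z - f 0) + - (g z - g 0)); last by rewrite fg0; ring.
  rewrite (le_trans (cnormD _ _))// cnormN; lra.
have e2 : 0 < e / 2 by rewrite divr_gt0.
have := IH _ _ (holomorphic_derive1 hf) (holomorphic_derive1 hg) _ _ e2.
move=> /(_ _)/near_cnbhsP; case=> [k kn|r1 r10 r1P].
  by move: (fg k.+1 kn); rewrite /derive1n !iterSr.
have /near_cnbhsP[r2 r20 r2P] := hf; have /near_cnbhsP[r3 r30 r3P] := hg.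
have [r r0 [rr1 rr2 rr3]] : exists2 r : R, 0 < r & [/\ r <= r1, r <= r2 & r <= r3].
  exists (Num.min r1 (Num.min r2 r3)); first by rewrite !lt_min r10 r20 r30.
  by rewrite !ge_min !lexx !orbT.
apply/near_cnbhsP; exists r => // z; rewrite subr0 => zr.
have fg0 : f 0 - g 0 = 0 by have /= := fg 0 (leq0n _) => ->; rewrite subrr.
have := @mean_value (fun w => f w + -1 * g w) z (e / 2 * N z ^+ n).
rewrite (_ : _ - _ = f z - g z); last by rewrite !mulN1r fg0 subr0.
rewrite exprSr (_ : 2 * _ = e * (N z ^+ n * N z)); last by field.
apply=> t t01.
have tz : N (t%:C%C * z) <= N z.
  by rewrite cnormM cnorm_real ger0_norm ?ler_piMl ?cnorm_ge0//; lra.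
have tr : N (t%:C%C * z - 0) < r by rewrite subr0 (le_lt_trans tz).
have f1 := cder_derive1 (r2P _ (lt_le_trans tr rr2)).
have g1 := cder_derive1 (r3P _ (lt_le_trans tr rr3)).
eexists; first exact: (cderD f1 (cderM (cder_cst (-1) _) g1)).
rewrite mul0r addr0 mulN1r (le_trans (r1P _ (lt_le_trans tr rr1)))//.
apply: ler_wpM2l; first exact: ltW.
by rewrite lerXn2r// nnegrE cnorm_ge0.
Qed.

End Peano.

(** * Derivatives of matrix functions, entry by entry *)

Section MatrixDerivative.
Variables (K : numFieldType) (m n : nat).

Lemma cvg_mxP (T : Type) (F : set_system T) (FF : Filter F) (f : T -> 'M[K]_(m, n)) (L : 'M[K]_(m, n)) :
  (f x @[x --> F] --> L) <-> forall i j, (f x i j : K^o) @[x --> F] --> (L i j : K^o).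
Proof.
split=> [fL i j P PL|H P [Q LQ QP]].
  apply: (fL [set M : 'M[K]_(m, n) | P (M i j)]).
  exists (fun i' j' => if (i' == i) && (j' == j) then P else setT).
    by move=> i' j'; case: ifP => [/andP[/eqP -> /eqP ->]//|_]; exact: filterT.
  by move=> M /(_ i j); rewrite !eqxx.
have : \forall x \near F, forall ij : 'I_m * 'I_n, Q ij.1 ij.2 (f x ij.1 ij.2).
  by apply: filter_forall => -[i j] /=; apply: H; exact: LQ.
by apply: filterS => x xQ; apply: QP => i j; exact: (xQ (i, j)).
Qed.

Lemma derivable_mxE (f : K^o -> 'M[K]_(m, n)) a :
  derivable f a 1 -> forall i j, derivable (fun w => f w i j : K^o) a 1 /\
     derive1 (fun w => f w i j : K^o) a = (derive1 f a) i j.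
Proof.
move=> fa i j.
have : (h^-1 *: ((f \o shift a) (h *: (1 : K^o)) - f a)) @[h --> (0 : K^o)^'] --> derive1 f a.
  by rewrite derive1E; exact: fa.
move=> /cvg_mxP => /(_ i j) H.
have {}H : (h^-1 *: (((fun w => f w i j : K^o) \o shift a) (h *: (1 : K^o)) - f a i j)) @[h --> (0 : K^o)^'] --> (derive1 f a i j : K^o).
  by move: H; under eq_fun do rewrite !mxE.
split; first by apply/cvg_ex; eexists; exact: H.
by rewrite [LHS]derive1E /derive; apply/cvg_lim => //; exact: H.
Qed.

Lemma derivable_entries (f : K^o -> 'M[K]_(m, n)) a :
  (forall i j, derivable (fun w => f w i j : K^o) a 1) -> derivable f a 1.
Proof.
move=> fa; apply/cvg_ex.
exists (\matrix_(i, j) derive1 (fun w => f w i j : K^o) a).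
apply/cvg_mxP => i j; rewrite mxE derive1E.
have := fa i j; rewrite /derivable /derive; set u := fun h => _.
set v := fun h => _; suff -> : v = u by [].
by apply/funext => h; rewrite /u /v /= !mxE.
Qed.

End MatrixDerivative.

Section MatrixTaylor.
Variable R : realType.
Local Notation C := (R[i]).
Local Notation N := (@cnorm R).

Lemma holomorphic_near_mxP m n (f : C^o -> 'M[C]_(m, n)) a :
  (\forall w \near cnbhs a, derivable f w 1) <->
  forall i j, holomorphic_near (fun w => f w i j) a.
Proof.
split=> [fa i j|fa].
  apply: filterS fa => w fw; have [fij _] := derivable_mxE fw i j.
  by eexists; exact: (derive_cder fij).
have : \forall w \near cnbhs a, forall ij : 'I_m * 'I_n, exists d, cder (fun w => f w ij.1 ij.2) w d.
  by apply: filter_forall => -[i j]; exact: fa.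
apply: filterS => w fw; apply: derivable_entries => i j.
by have [d /cder_derive[]] := fw (i, j).
Qed.

Lemma near_eq_derive1 (f g : C^o -> C^o) a :
  (\forall w \near cnbhs a, f w = g w) -> \forall w \near cnbhs a, derive1 f w = derive1 g w.
Proof.
by move=> /near_near; apply: filterS => w fg; rewrite !derive1E; apply: near_eq_derive.
Qed.

(** Taking an entry commutes with the first derivative only near 0, so iterates are compared as
    functions equal on a neighbourhood. To continue, [derive1 f] must again be derivable near 0,
    which is [holomorphic_derive1] on each entry. *)
Lemma derive1n_mxE m n k (f : C^o -> 'M[C]_(m, n)) i j :
  (\forall w \near cnbhs 0, derivable f w 1) ->
  derive1n k (fun w => f w i j : C^o) 0 = derive1n k f 0 i j.
Proof.
rewrite /derive1n; elim: k f => [//|k IH] f fn; rewrite !iterSr.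
have E : \forall w \near cnbhs 0, derive1 (fun w => f w i j : C^o) w = derive1 f w i j.
  by apply: filterS fn => w /derivable_mxE/(_ i j)[].
have {}E : iter k (@derive1 C C^o) (derive1 (fun w => f w i j : C^o)) 0 =
   iter k (@derive1 C C^o) (fun w => derive1 f w i j : C^o) 0.
  suff : \forall w \near cnbhs 0, iter k (@derive1 C C^o) (derive1 (fun w => f w i j : C^o)) w =
      iter k (@derive1 C C^o) (fun w => derive1 f w i j : C^o) w by exact: near_self.
  elim: k {IH} => [//|k IH]; exact: (near_eq_derive1 IH).
rewrite E; apply: IH; apply/holomorphic_near_mxP => i' j'.
have := holomorphic_derive1 ((holomorphic_near_mxP f 0).1 fn i' j').
have {}E : \forall w \near cnbhs 0, derive1 (fun w => f w i' j' : C^o) w = derive1 f w i' j'.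
  by apply: filterS fn => w /derivable_mxE/(_ i' j')[].
move=> H; apply: filterS2 (near_near E) H => w Ew [d dw].
by exists d; apply: (cder_near Ew).
Qed.

End MatrixTaylor.

(** * The indefinite form *)

Section Algebra.
Variable R : realType.
Local Notation C := (R[i]).

Lemma adjM m n q (A : 'M[C]_(m, n)) (B : 'M[C]_(n, q)) : adj (A *m B) = adj B *m adj A.
Proof. by rewrite /adj map_mxM trmx_mul. Qed.

Lemma adjK m n (A : 'M[C]_(m, n)) : adj (adj A) = A.
Proof. by apply/matrixP => i j; rewrite !mxE conjCK. Qed.

Lemma adjD m n (A B : 'M[C]_(m, n)) : adj (A + B) = adj A + adj B.
Proof. by apply/matrixP => i j; rewrite !mxE rmorphD. Qed.

Lemma adjN m n (A : 'M[C]_(m, n)) : adj (- A) = - adj A.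
Proof. by apply/matrixP => i j; rewrite !mxE rmorphN. Qed.

Lemma adjZ m n (c : C) (A : 'M[C]_(m, n)) : adj (c *: A) = Num.conj c *: adj A.
Proof. by apply/matrixP => i j; rewrite !mxE rmorphM. Qed.

Lemma adj_scalar n (c : C) : adj (c%:M : 'M[C]_n) = (Num.conj c)%:M.
Proof. by rewrite /adj map_scalar_mx tr_scalar_mx. Qed.

Lemma adj1 n : adj (1%:M : 'M[C]_n) = 1%:M.
Proof. by rewrite adj_scalar rmorph1. Qed.

Lemma adj0 m n : adj (0 : 'M[C]_(m, n)) = 0.
Proof. by rewrite /adj map_mx0 trmx0. Qed.

Lemma adj_block m1 m2 n1 n2 (A : 'M[C]_(m1, n1)) B D (E : 'M[C]_(m2, n2)) :
  adj (block_mx A B D E) = block_mx (adj A) (adj D) (adj B) (adj E).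
Proof. by rewrite /adj map_block_mx tr_block_mx. Qed.

Lemma adj_col m1 m2 n (A : 'M[C]_(m1, n)) (B : 'M[C]_(m2, n)) :
  adj (col_mx A B) = row_mx (adj A) (adj B).
Proof. by rewrite /adj map_col_mx tr_col_mx. Qed.

Variable p : nat.
Local Notation j := (jmat R p).
Local Notation K := (Kmat R p).

Lemma adj_j : adj j = j.
Proof. by rewrite /jmat adj_block adjN !adj1 !adj0. Qed.

Lemma jj1 : j *m j = 1%:M.
Proof.
rewrite /jmat mulmx_block !mul1mx !mulmx0 !mul0mx !addr0 add0r mulNmx mul1mx.
by rewrite opprK -scalar_mx_block.
Qed.

Let c : C := (((Num.sqrt (2 : R))^-1)%:C)%C.

Let cc : c * c = 2^-1.
Proof.
rewrite /c -rmorphM/= -invfM -expr2 sqr_sqrtr// fmorphV/=.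
by congr (_^-1); rewrite rmorph_nat.
Qed.

Let conjc_c : Num.conj c = c.
Proof. by rewrite /c; apply/CrealP; rewrite complex_real. Qed.

Lemma adj_K : adj K = c *: block_mx 1%:M 1%:M (- 1%:M) 1%:M.
Proof. by rewrite /Kmat adjZ conjc_c adj_block adjN !adj1. Qed.

Let half_block (A : 'M[C]_p) : 2^-1 *: (A + A) = A.
Proof. by rewrite scalerDr -scalerDl -[RHS]scale1r [in RHS](splitr 1) !mul1r. Qed.

Lemma K_adjK : K *m adj K = 1%:M.
Proof.
rewrite adj_K /Kmat -scalemxAl -scalemxAr scalerA cc mulmx_block.
rewrite !mulNmx !mulmxN !mulmx1 opprK ?subrr ?addNr scale_block_mx !half_block !scaler0.
by rewrite -scalar_mx_block.
Qed.

Lemma adjK_K : adj K *m K = 1%:M.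
Proof. exact: (mulmx1C K_adjK). Qed.

(** With b = beta K, this turns the normalisation beta J beta^* = 1 into b j b^* = 1. *)
Lemma KjK : K *m j *m adj K = Jmat R p.
Proof.
rewrite adj_K /Kmat /jmat /Jmat -scalemxAl -scalemxAl -scalemxAr scalerA cc !mulmx_block.
rewrite ?mulmx0 ?oppr0 ?addr0 ?add0r ?mulNmx ?mulmxN ?mulmx1 ?mulNmx ?mulmx1 ?opprK.
rewrite ?subrr ?addNr scale_block_mx !scaler0.
by rewrite !half_block.
Qed.

Section Projection.
Variable b : 'M[C]_(p, p + p).
Hypothesis bjb : b *m j *m adj b = 1%:M.

Definition proj := adj b *m b *m j.

Lemma bj_proj : b *m j *m proj = b *m j.
Proof. by rewrite /proj !mulmxA bjb mul1mx. Qed.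

Lemma proj_idem : proj *m proj = proj.
Proof. by rewrite {1}/proj -(mulmxA (adj b)) -mulmxA bj_proj mulmxA. Qed.

(** With u = b j v, the image w = v - b^* u satisfies w^* j w = v^* j v - u^* u, so the form
    decreases. If w = 0, then u^* u = v^* j v <= 0, whence u = 0 and v = b^* u = 0. *)
Lemma cone_step (v : 'cV[C]_(p + p)) : (adj v *m j *m v) 0 0 <= 0 ->
  (adj ((1%:M - proj) *m v) *m j *m ((1%:M - proj) *m v)) 0 0 <= 0 /\
  ((1%:M - proj) *m v = 0 -> v = 0).
Proof.
move=> v0; set w := _ *m v; set u := b *m j *m v.
have wE : w = v - adj b *m u by rewrite /w mulmxBl mul1mx /proj /u !mulmxA.
have uv : adj v *m j *m adj b = adj u by rewrite /u !adjM adj_j mulmxA.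
have e : adj w *m j *m w = adj v *m j *m v - adj u *m u.
  rewrite wE adjD adjN adjM adjK !mulmxDl !mulNmx !mulmxDr !mulmxN.
  have e1 : b *m (j *m v) = u by rewrite mulmxA.
  have e2 : b *m (j *m (adj b *m u)) = u by rewrite 2!mulmxA bjb mul1mx.
  have e3 : adj v *m j *m (adj b *m u) = adj u *m u by rewrite mulmxA uv.
  by rewrite e3 -!mulmxA e1 e2 subrr subr0.
have uE : (adj u *m u) 0 0 = \sum_i `|u i 0| ^+ 2.
  by rewrite mxE; apply: eq_bigr => i _; rewrite !mxE normCK mulrC.
have u0 : 0 <= (adj u *m u) 0 0 by rewrite uE sumr_ge0// => i _; rewrite exprn_ge0.
have e00 : (adj w *m j *m w) 0 0 = (adj v *m j *m v) 0 0 - (adj u *m u) 0 0.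
  by rewrite e !mxE.
split; first by rewrite e00 subr_le0 (le_trans v0).
move=> w0; have : (adj u *m u) 0 0 = 0.
  move/eqP: e00; rewrite w0 mulmx0 mxE eq_sym subr_eq0 => /eqP vu.
  by apply/eqP; rewrite eq_le u0 -vu v0.
rewrite uE => /psumr_eq0P uz.
have {}uz : u = 0.
  apply/matrixP => i k; rewrite ord1 [RHS]mxE; apply/eqP.
  by rewrite -normr_eq0 -sqrf_eq0 uz// => i' _; rewrite exprn_ge0.
move: w0; rewrite /w mulmxBl mul1mx => /eqP; rewrite subr_eq0 => /eqP ->.
by rewrite /proj -!mulmxA (mulmxA b j) -/u uz mulmx0.
Qed.

End Projection.

(** The left kernel of [Y] has dimension 2p - p = p, the rank of both matrices b j, so their row
    spaces coincide with it. Then b1 = U b2, the normalisations make U unitary, and U cancels in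
    b1^* b1. *)
Lemma row_space_unique (b1 b2 : 'M[C]_(p, p + p)) (Y : 'M[C]_(p + p, p)) :
  b1 *m j *m adj b1 = 1%:M -> b2 *m j *m adj b2 = 1%:M ->
  (forall x : 'cV[C]_p, Y *m x = 0 -> x = 0) ->
  b1 *m j *m Y = 0 -> b2 *m j *m Y = 0 -> adj b1 *m b1 = adj b2 *m b2.
Proof.
move=> h1 h2 Yinj y1 y2.
have rk (b : 'M[C]_(p, p + p)) : b *m j *m adj b = 1%:M -> \rank (b *m j) = p.
  by move=> h; apply/eqP; rewrite eqn_leq rank_leq_row row_leq_rank; apply/row_freeP; exists (adj b).
have rkY : \rank Y = p.
  rewrite -mxrank_tr; apply/eqP; rewrite eqn_leq rank_leq_row row_leq_rank -kermx_eq0.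
  apply/eqP/row_matrixP => i; rewrite row0.
  have : row i (kermx Y^T) *m Y^T = 0 by rewrite -row_mul mulmx_ker row0.
  by move=> /(congr1 trmx); rewrite trmx_mul trmxK trmx0 => /Yinj/(congr1 trmx); rewrite trmxK trmx0.
have rker : \rank (kermx Y) = p by rewrite mxrank_ker rkY addnK.
have s1 : (b1 *m j <= kermx Y)%MS by apply/sub_kermxP.
have s2 : (b2 *m j <= kermx Y)%MS by apply/sub_kermxP.
have s3 : (kermx Y <= b2 *m j)%MS by rewrite -(mxrank_leqif_sup s2) rk// rker.
have /submxP[U bU] := submx_trans s1 s3.
have b1U : b1 = U *m b2.
  by rewrite -[b1]mulmx1 -jj1 mulmxA bU -!mulmxA jj1 mulmx1.
have UU : U *m adj U = 1%:M.
  by rewrite -h1 b1U adjM -!mulmxA (mulmxA b2) (mulmxA (b2 *m j)) h2 mul1mx.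
by rewrite b1U adjM -mulmxA (mulmxA (adj U)) (mulmx1C UU) mul1mx.
Qed.

End Algebra.

(** * Entrywise limits of matrix functions *)

Section EntrywiseLimits.
Variable R : realType.
Local Notation C := (R[i]).
Local Notation N := (@cnorm R).

(** The neighbourhoods include [a] itself, so [L] is necessarily [f a], and [mxlim a f (f a)]
    expresses continuity at [a]. *)
Definition mxlim m n (a : C) (f : C -> 'M[C]_(m, n)) (L : 'M[C]_(m, n)) :=
  forall i j, (f z i j : C^o) @[z --> cnbhs a] --> (L i j : C^o).

Lemma cvgC_big (op : C -> C -> C) (x0 : C) I (r : seq I) (P : pred I) (f : I -> C -> C) l (a : C) :
  (forall g h u v, (g z : C^o) @[z --> cnbhs a] --> (u : C^o) ->
     (h z : C^o) @[z --> cnbhs a] --> (v : C^o) ->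
     (op (g z) (h z) : C^o) @[z --> cnbhs a] --> (op u v : C^o)) ->
  (forall i, (f i z : C^o) @[z --> cnbhs a] --> (l i : C^o)) ->
  (\big[op/x0]_(i <- r | P i) f i z : C^o) @[z --> cnbhs a] -->
    (\big[op/x0]_(i <- r | P i) l i : C^o).
Proof.
move=> opc fl; elim: r => [|i r IH].
  by rewrite big_nil; under eq_fun do rewrite big_nil; exact: cvg_cst.
rewrite big_cons; under eq_fun do rewrite big_cons.
by case: ifP => _; [apply: opc; [exact: fl|exact: IH]|exact: IH].
Qed.

Lemma cvgC_sum I (r : seq I) (P : pred I) (f : I -> C -> C) l (a : C) :
  (forall i, (f i z : C^o) @[z --> cnbhs a] --> (l i : C^o)) ->
  (\sum_(i <- r | P i) f i z : C^o) @[z --> cnbhs a] --> (\sum_(i <- r | P i) l i : C^o).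
Proof. by move=> fl; apply: cvgC_big fl => g h u v gu hv; apply: cvgD; [exact: gu|exact: hv]. Qed.

Lemma cvgC_prod I (r : seq I) (P : pred I) (f : I -> C -> C) l (a : C) :
  (forall i, (f i z : C^o) @[z --> cnbhs a] --> (l i : C^o)) ->
  (\prod_(i <- r | P i) f i z : C^o) @[z --> cnbhs a] --> (\prod_(i <- r | P i) l i : C^o).
Proof. by move=> fl; apply: cvgC_big fl => g h u v gu hv; apply: cvgM; [exact: gu|exact: hv]. Qed.

Lemma mxlim_cst m n a (A : 'M[C]_(m, n)) : mxlim a (fun=> A) A.
Proof. by move=> i j; exact: cvg_cst. Qed.

Lemma mxlimD m n a (f g : C -> 'M[C]_(m, n)) A B : mxlim a f A -> mxlim a g B ->
  mxlim a (fun z => f z + g z) (A + B).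
Proof.
move=> fA gB i j; rewrite mxE; under eq_fun do rewrite mxE.
by apply: cvgD; [exact: fA|exact: gB].
Qed.

Lemma mxlimZ m n a (c : C -> C) (f : C -> 'M[C]_(m, n)) l A :
  (c z : C^o) @[z --> cnbhs a] --> (l : C^o) -> mxlim a f A ->
  mxlim a (fun z => c z *: f z) (l *: A).
Proof.
move=> cl fA i j; rewrite mxE; under eq_fun do rewrite mxE.
by apply: cvgM; [exact: cl|exact: fA].
Qed.

Lemma mxlimM m n q a (f : C -> 'M[C]_(m, n)) (g : C -> 'M[C]_(n, q)) A B :
  mxlim a f A -> mxlim a g B -> mxlim a (fun z => f z *m g z) (A *m B).
Proof.
move=> fA gB i j; rewrite mxE; under eq_fun do rewrite mxE.
by apply: cvgC_sum => k; apply: cvgM; [exact: fA|exact: gB].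
Qed.

Lemma mxlim_col m1 m2 n a (f : C -> 'M[C]_(m1, n)) (g : C -> 'M[C]_(m2, n)) A B :
  mxlim a f A -> mxlim a g B -> mxlim a (fun z => col_mx (f z) (g z)) (col_mx A B).
Proof.
move=> fA gB i j; rewrite mxE; under eq_fun do rewrite mxE.
by case: (fintype.split i) => k; [exact: fA|exact: gB].
Qed.

Lemma mxlim_usub m1 m2 n a (f : C -> 'M[C]_(m1 + m2, n)) A :
  mxlim a f A -> mxlim a (fun z => usubmx (f z)) (usubmx A).
Proof. by move=> fA i j; rewrite mxE; under eq_fun do rewrite mxE; exact: fA. Qed.

Lemma cvgC_det n a (f : C -> 'M[C]_n) A : mxlim a f A ->
  (\det (f z) : C^o) @[z --> cnbhs a] --> (\det A : C^o).
Proof.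
move=> fA; rewrite /determinant; apply: cvgC_sum => s.
apply: cvgM; first exact: cvg_cst.
by apply: cvgC_prod => i; exact: fA.
Qed.

Lemma mxlim_near m n a (f g : C -> 'M[C]_(m, n)) A :
  (\forall z \near cnbhs a, f z = g z) -> mxlim a f A -> mxlim a g A.
Proof.
move=> fg fA i j; apply: cvg_trans (fA i j); apply: near_eq_cvg.
by apply: filterS fg => z ->.
Qed.

(** By Cramer's rule the inverse is a quotient of determinants. Invertibility near [a] is needed
    because [invmx] returns its argument on singular matrices. *)
Lemma mxlim_inv n a (f : C -> 'M[C]_n) A : A \in unitmx -> mxlim a f A ->
  (\forall z \near cnbhs a, f z \in unitmx) -> mxlim a (fun z => invmx (f z)) (invmx A).
Proof.
move=> Au fA fu.
have adjl : mxlim a (fun z => \adj (f z)) (\adj A).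
  have adjE (B : 'M[C]_n) i j : \adj B i j = cofactor B j i by rewrite mxE.
  move=> i j; have -> := adjE A i j.
  have -> : (fun z => \adj (f z) i j) = (fun z => cofactor (f z) j i).
    by apply/funext => z; exact: adjE.
  rewrite /cofactor; apply: cvgM; first exact: cvg_cst.
  apply: cvgC_det => i' j'; rewrite !mxE; under eq_fun do rewrite !mxE.
  exact: fA.
have dA : \det A != 0 by move: Au; rewrite unitmxE unitfE.
have H : mxlim a (fun z => (\det (f z))^-1 *: \adj (f z)) ((\det A)^-1 *: \adj A).
  by apply: mxlimZ => //; apply: cvgV => //; exact: cvgC_det.
rewrite {2}/invmx Au; apply: mxlim_near H.
by apply: filterS fu => z zu; rewrite /invmx zu.
Qed.

Lemma mxlim_unique m n a (f g : C -> 'M[C]_(m, n)) A B :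
  (\forall z \near cnbhs a, z != a -> f z = g z) -> mxlim a f A -> mxlim a g B -> A = B.
Proof.
move=> fg fA gB; apply/matrixP => i j; apply/eqP; rewrite -subr_eq0 -[_ == 0]negbK -cnorm_gt0.
apply/negP => e0; have e2 : 0 < N (A i j - B i j) / 2 by rewrite divr_gt0.
have /cvgCP/(_ _ e2) h1 := fA i j; have /cvgCP/(_ _ e2) h2 := gB i j.
have /near_cnbhsP[r r0 rP] : \forall z \near cnbhs a, [/\ z != a -> f z = g z,
    N (f z i j - A i j) < N (A i j - B i j) / 2 & N (g z i j - B i j) < N (A i j - B i j) / 2].
  by apply: filterS3 fg h1 h2 => z; split.
(* A point of the neighbourhood distinct from [a], where [f] and [g] agree. *)
pose z : C := a + (r / 2)%:C%C.
have r2 : 0 < r / 2 by rewrite divr_gt0.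
have zr : N (z - a) < r by rewrite /z addrC addKr cnorm_real gtr0_norm//; lra.
have [fgz fz gz] := rP z zr.
have za : z != a by rewrite -subr_eq0 -cnorm_gt0 /z addrC addKr cnorm_real normr_gt0 lt0r_neq0.
rewrite -(fgz za) in gz.
have := cnormD (A i j - f z i j) (f z i j - B i j).
rewrite subrKA [N (A i j - f z i j)]cnormB; lra.
Qed.

(** Off 0, G = M (z^-n E), and z^-n E tends to 0 because E is o(z^n) while M stays bounded. *)
Lemma cancel_order n m q s (M : C -> 'M[C]_(m, q)) M0 (E : C -> 'M[C]_(q, s)) (G : C -> 'M[C]_(m, s)) G0 :
  mxlim 0 M M0 -> mxlim 0 G G0 ->
  (forall i j (e : R), 0 < e -> \forall z \near cnbhs 0, N (E z i j) <= e * N z ^+ n) ->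
  (\forall z \near cnbhs 0, M z *m E z = z ^+ n *: G z) -> G0 = 0.
Proof.
move=> MM GG Eo H.
(* The value 0 at [z = 0] is imposed by hand, since [mxlim] takes the centre into account. *)
have E0 : mxlim 0 (fun z => if z == 0 then 0 else z ^- n *: E z) 0.
  move=> i j; rewrite mxE; apply/cvgCP => e e0; have e2 : 0 < e / 2 by rewrite divr_gt0.
  apply: filterS (Eo i j _ e2) => z; rewrite subr0; case: eqVneq => [_ _|z0].
    by rewrite mxE cnorm0.
  have nX : N (z ^+ n) = N z ^+ n.
    elim: (n) => [|k IH]; last by rewrite !exprS cnormM IH.
    by rewrite !expr0 -(rmorph1 (real_complex R)) cnorm_real normr1.
  have zn : 0 < N z ^+ n by rewrite exprn_gt0// cnorm_gt0.
  rewrite mxE cnormM cnormV nX => h.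
  by rewrite mulrC ltr_pdivrMr// (le_lt_trans h)// ltr_pM2r//; lra.
rewrite -(mulmx0 _ M0); apply: mxlim_unique GG (mxlimM MM E0).
apply: filterS H => z Hz z0; rewrite (negPf z0) -scalemxAr Hz scalerA mulVf ?scale1r//.
by rewrite expf_neq0.
Qed.

End EntrywiseLimits.

(** * Blaschke-Potapov factors *)

Section Products.
Variables (R : realType) (p : nat).
Local Notation C := (R[i]).
Local Notation N := (@cnorm R).
Local Notation j := (jmat R p).
Implicit Types (Cs : nat -> 'M[C]_(p + p)) (beta : nat -> 'M[C]_(p, p + p)) (z : C).

Definition Cproj Cs k : 'M[C]_(p + p) := 2^-1 *: (1%:M + Cs k *m j).
Definition blaschke Cs k z := (1%:M - Cproj Cs k) + z *: Cproj Cs k.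
Definition coblaschke Cs k z := z *: (1%:M - Cproj Cs k) + Cproj Cs k.

Fixpoint blaschke_prod Cs n d z : 'M[C]_(p + p) :=
  if d is d'.+1 then blaschke Cs n z *m blaschke_prod Cs n.+1 d' z else 1%:M.

(** The indices decrease from left to right, so that against A_0 ... A_(n-1) the innermost pair of
    index 0 collapses first, to the scalar z, and then the others in turn. *)
Fixpoint coblaschke_prod Cs n z : 'M[C]_(p + p) :=
  if n is n'.+1 then coblaschke Cs n' z *m coblaschke_prod Cs n' z else 1%:M.

Lemma blaschke_prod_cat Cs n d1 d2 z :
  blaschke_prod Cs n (d1 + d2) z = blaschke_prod Cs n d1 z *m blaschke_prod Cs (n + d1) d2 z.
Proof.
elim: d1 n => [|d1 IH] n /=; first by rewrite mul1mx addn0.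
by rewrite IH mulmxA addSnnS.
Qed.

Lemma blaschke_prod_cons Cs n d z : blaschke_prod Cs n d.+1 z = blaschke Cs n z *m blaschke_prod Cs n.+1 d z.
Proof. by []. Qed.

Lemma blaschke_prod_rcons Cs n z : blaschke_prod Cs 0 n.+1 z = blaschke_prod Cs 0 n z *m blaschke Cs n z.
Proof. by rewrite -addn1 blaschke_prod_cat add0n /= mulmx1. Qed.

Lemma blaschke_prod_ext Cs Ds n d z : (forall k, (n <= k < n + d)%N -> Cs k = Ds k) ->
  blaschke_prod Cs n d z = blaschke_prod Ds n d z.
Proof.
elim: d n => [//|d IH] n H /=; rewrite (IH n.+1).
  by rewrite /blaschke /Cproj H// leqnn -addSnnS leq_addr.
by move=> k /andP[nk kd]; apply: H; rewrite (ltnW nk)/= -addSnnS.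
Qed.

Lemma coblaschkeK Cs k z : Cproj Cs k *m Cproj Cs k = Cproj Cs k -> coblaschke Cs k z *m blaschke Cs k z = z%:M.
Proof.
rewrite /coblaschke /blaschke; move: (Cproj Cs k) => P PP.
have e1 : (1%:M - P) *m P = 0 by rewrite mulmxBl mul1mx PP subrr.
have e2 : P *m (1%:M - P) = 0 by rewrite mulmxBr mulmx1 PP subrr.
have e3 : (1%:M - P) *m (1%:M - P) = 1%:M - P by rewrite mulmxBr mulmx1 e1 subr0.
have e4 : (1%:M - P) + P = 1%:M by rewrite subrK.
move: (1%:M - P) e1 e2 e3 e4 => Q e1 e2 e3 e4.
rewrite mulmxDl !mulmxDr -!scalemxAr -!scalemxAl e1 e2 e3 PP !scaler0 add0r addr0.
by rewrite -scalerDr e4 scalemx1.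
Qed.

Lemma coblaschke_prodK Cs n z : (forall k, (k < n)%N -> Cproj Cs k *m Cproj Cs k = Cproj Cs k) ->
  coblaschke_prod Cs n z *m blaschke_prod Cs 0 n z = (z ^+ n)%:M.
Proof.
elim: n => [|n IH] H; first by rewrite /= mul1mx expr0.
have -> : coblaschke_prod Cs n.+1 z = coblaschke Cs n z *m coblaschke_prod Cs n z by [].
rewrite blaschke_prod_rcons -mulmxA (mulmxA (coblaschke_prod _ _ _)) IH; last first.
  by move=> k kn; apply: H; rewrite ltnS ltnW.
by rewrite mul_scalar_mx -scalemxAr coblaschkeK ?H// scale_scalar_mx exprSr.
Qed.

Lemma mxlim_blaschke Cs k : mxlim 0 (blaschke Cs k) (blaschke Cs k 0).
Proof.
by apply: mxlimD; [exact: mxlim_cst|apply: mxlimZ; [exact: ccont_id|exact: mxlim_cst]].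
Qed.

Lemma mxlim_blaschke_prod Cs n d : mxlim 0 (blaschke_prod Cs n d) (blaschke_prod Cs n d 0).
Proof.
elim: d n => [|d IH] n /=; first exact: mxlim_cst.
by apply: mxlimM; [exact: mxlim_blaschke|exact: IH].
Qed.

Lemma mxlim_coblaschke_prod Cs n : mxlim 0 (coblaschke_prod Cs n) (coblaschke_prod Cs n 0).
Proof.
elim: n => [|n IH] /=; first exact: mxlim_cst.
apply: mxlimM; last exact: IH.
by apply: mxlimD; [apply: mxlimZ; [exact: ccont_id|exact: mxlim_cst]|exact: mxlim_cst].
Qed.

Lemma Cmat_adj beta k : adj (Cmat beta k) = Cmat beta k.
Proof.
rewrite /Cmat adjD adjN adj_j adjZ !adjM !adjK !mulmxA.
by congr (_ *: _ - _); rewrite rmorph_nat.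
Qed.

Lemma Cproj_proj beta k : Cproj (Cmat beta) k = proj (beta k *m Kmat R p).
Proof.
rewrite /Cproj /Cmat /proj adjM mulmxBl jj1 addrC subrK -scalemxAl scalerA mulVf ?pnatr_eq0//.
by rewrite scale1r !mulmxA.
Qed.

Lemma betaK_j (b : 'M[C]_(p, p + p)) : b *m Jmat R p *m adj b = 1%:M ->
  (b *m Kmat R p) *m j *m adj (b *m Kmat R p) = 1%:M.
Proof. by rewrite adjM -KjK !mulmxA. Qed.

(** C_k j = 2P - 1, and 1 - t = 2/(z + 1), 1 + t = 2z/(z + 1) for t = (z - 1)/(z + 1): these are the
    coefficients of 1 - P and P. *)
Lemma blaschke_mobius Cs k z : z + 1 != 0 ->
  1%:M + ((z - 1) / (z + 1)) *: (Cs k *m j) = (2 / (z + 1)) *: blaschke Cs k z.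
Proof.
move=> z1; rewrite /blaschke /Cproj; set D := Cs k *m j.
apply/matrixP => r s; rewrite !mxE; field.
by [].
Qed.

(** The conformal map of the unit disc onto the lower half-plane that takes 0 to -i. *)
Definition mobius z : C := 'i * (z + 1) / (z - 1).

Lemma i_mobius z : z + 1 != 0 -> z - 1 != 0 -> 'i / mobius z = (z - 1) / (z + 1).
Proof.
move=> h1 h2; have i0 : ('i : C) != 0 by exact: neq0Ci.
by rewrite /mobius; field; rewrite i0 h1 h2.
Qed.

(** The adjoint reverses the order of the factors and, as the conjugate of i / conj(lambda) is
    -i/lambda, turns each step into right multiplication by 1 + (i/lambda) C_k j. *)
Lemma adj_Wsys Cs n z : (forall k, adj (Cs k) = Cs k) -> z + 1 != 0 -> z - 1 != 0 ->
  adj (Wsys Cs n (Num.conj (mobius z))) = (2 / (z + 1)) ^+ n *: blaschke_prod Cs 0 n z.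
Proof.
move=> herm h1 h2; elim: n => [|n IH]; first by rewrite /= adj1 expr0 scale1r.
rewrite blaschke_prod_rcons [Wsys _ _ _]/= adjD adjN adjZ !adjM herm adj_j IH.
have -> : Num.conj ('i / Num.conj (mobius z)) = - ((z - 1) / (z + 1)).
  by rewrite rmorphM fmorphV/= conjCK conjCi mulNr i_mobius.
rewrite scaleNr opprK.
set P := blaschke_prod Cs 0 n z; set c := (2 / (z + 1)).
have -> : c ^+ n.+1 *: (P *m blaschke Cs n z) = (c ^+ n *: P) *m (c *: blaschke Cs n z).
  by rewrite -scalemxAr -scalemxAl scalerA -exprS.
by rewrite -blaschke_mobius// mulmxDr mulmx1 -scalemxAr mulmxA.
Qed.

Lemma blaschke0_cone beta k (v : 'cV[C]_(p + p)) : beta k *m Jmat R p *m adj (beta k) = 1%:M ->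
  (adj v *m j *m v) 0 0 <= 0 ->
  (adj (blaschke (Cmat beta) k 0 *m v) *m j *m (blaschke (Cmat beta) k 0 *m v)) 0 0 <= 0 /\
  (blaschke (Cmat beta) k 0 *m v = 0 -> v = 0).
Proof. by move=> /betaK_j bj; rewrite /blaschke scale0r addr0 Cproj_proj; exact: cone_step. Qed.

Lemma blaschke_prod0_cone beta n d (v : 'cV[C]_(p + p)) :
  (forall k, (n <= k < n + d)%N -> beta k *m Jmat R p *m adj (beta k) = 1%:M) ->
  (adj v *m j *m v) 0 0 <= 0 ->
  let w := blaschke_prod (Cmat beta) n d 0 *m v in
  (adj w *m j *m w) 0 0 <= 0 /\ (w = 0 -> v = 0).
Proof.
elim: d n => [|d IH] n H v0 /=; first by rewrite mul1mx.
have H' k : (n.+1 <= k < n.+1 + d)%N -> beta k *m Jmat R p *m adj (beta k) = 1%:M.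
  by move=> /andP[nk kd]; apply: H; rewrite (ltnW nk)/= -addSnnS.
have hn : beta n *m Jmat R p *m adj (beta n) = 1%:M.
  by apply: H; rewrite leqnn -addSnnS leq_addr.
have [w0 wv] := IH n.+1 H' v0.
have [u0 uw] := blaschke0_cone hn w0.
rewrite -(mulmxA (blaschke (Cmat beta) n 0)); split; first exact: u0.
by move=> h; exact: wv (uw h).
Qed.

End Products.

(** * Weyl functions near the base point *)

Section Weyl.
Variables (R : realType) (p : nat).
Local Notation C := (R[i]).
Local Notation N := (@cnorm R).
Local Notation j := (jmat R p).
Local Notation K := (Kmat R p).
Local Notation mob := (@mobius R).

Lemma cder_mobius z : z - 1 != 0 -> exists d, cder mob z d.
Proof.
move=> z1.
have d1 : cder (fun w : C^o => w + 1 : C^o) z (1 + 0) by apply: cderD; [exact: cder_id|exact: cder_cst].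
have d2 : cder (fun w : C^o => w - 1 : C^o) z (1 + 0) by apply: cderD; [exact: cder_id|exact: cder_cst].
by eexists; exact: (cderM (cderM (cder_cst 'i z) d1) (cderV d2 z1)).
Qed.

Lemma mobius0 : mob 0 = - 'i.
Proof. by rewrite /mobius add0r sub0r mulr1 invrN1 mulrN1. Qed.

Lemma ccont_mobius0 : (mob z : C^o) @[z --> cnbhs 0] --> (- 'i : C^o).
Proof.
have [|d /cder_ccont] := @cder_mobius 0; first by rewrite sub0r oppr_eq0 oner_eq0.
by rewrite /ccont mobius0.
Qed.

Lemma near_mobius (P : C -> Prop) : (\forall w \near cnbhs (- 'i), P w) ->
  \forall z \near cnbhs 0, P (mob z).
Proof. by move=> H; exact: ccont_mobius0 H. Qed.

Lemma near_mobius_poles : \forall z \near cnbhs (0 : C), z + 1 != 0 /\ z - 1 != 0.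
Proof.
apply/near_cnbhsP; exists 1 => // z; rewrite subr0 => z1; split; apply: contraTneq z1.
  move/eqP; rewrite addr_eq0 => /eqP ->.
  by rewrite cnormN -(rmorph1 (real_complex R)) cnorm_real normr1 ltxx.
move/eqP; rewrite subr_eq0 => /eqP ->.
by rewrite -(rmorph1 (real_complex R)) cnorm_real normr1 ltxx.
Qed.

Lemma near_lowerH : \forall w \near cnbhs (- 'i), lowerH (w : C).
Proof.
apply/near_cnbhsP; exists 1 => // w w1; rewrite /lowerH /=.
have -> : 'Im w = (complex.Im w)%:C%C.
  apply: (mulfI (neq0Ci C)); rewrite ImE.
  case: w w1 => x y _; apply/eqP; rewrite eq_complex /=.
  by apply/andP; split; apply/eqP; field.
rewrite -[0]/(0%:C%C) ltcR.
have := cnorm_Im (w - - 'i); rewrite raddfB /= opprK => h.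
by have := le_lt_trans h w1; rewrite ltr_norml; lra.
Qed.

Lemma mxlim_regular m n (F : C^o -> 'M[C]_(m, n)) : regular_at F (- 'i) ->
  mxlim 0 (fun z => F (mob z)) (F (- 'i)).
Proof.
move=> Freg r s.
have /near_self Fd : \forall w \near cnbhs (- 'i), derivable F w 1 by exact: Freg.
have [/derive_cder/cder_ccont Fc _] := derivable_mxE Fd r s.
apply: (@cvg_comp _ _ _ (mob : C -> C^o) (fun w => F w r s : C^o) _ _ _ ccont_mobius0).
exact: Fc.
Qed.

Lemma usubmx_mul (W : 'M[C]_(p + p)) (A B : 'M[C]_p) :
  usubmx (W *m col_mx A B) = ulsubmx W *m A + ursubmx W *m B.
Proof. by rewrite -{1}[W]submxK mul_block_col col_mxKu. Qed.

Lemma dsubmx_mul (W : 'M[C]_(p + p)) (A B : 'M[C]_p) :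
  dsubmx (W *m col_mx A B) = dlsubmx W *m A + drsubmx W *m B.
Proof. by rewrite -{1}[W]submxK mul_block_col col_mxKd. Qed.

(** The form of j on (A; B) y equals -y^* (B^* B - A^* A) y; a vector y killed by both blocks
    contradicts positive definiteness unless it is 0. *)
Lemma cone_col (A B : 'M[C]_p) (y : 'cV[C]_p) :
  posdef (adj A *m A + adj B *m B) -> psd (adj B *m B - adj A *m A) ->
  (adj (col_mx A B *m y) *m j *m (col_mx A B *m y)) 0 0 <= 0 /\
  (col_mx A B *m y = 0 -> y = 0).
Proof.
move=> pd ps; split.
  have -> : adj (col_mx A B *m y) *m j *m (col_mx A B *m y) =
      - (adj y *m (adj B *m B - adj A *m A) *m y).
    have M : adj (col_mx A B) *m j *m col_mx A B = - (adj B *m B - adj A *m A).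
      rewrite adj_col /jmat mul_row_block !mulmx1 !mulmx0 addr0 add0r mul_row_col.
      by rewrite mulmxN mulmx1 mulNmx opprB.
    by rewrite -mulNmx -mulmxN -M adjM !mulmxA.
  by rewrite mxE oppr_le0; exact: ps.
rewrite mul_col_mx => /eqP; rewrite col_mx_eq0 => /andP[/eqP Ay /eqP By].
apply/eqP; apply: contraT => /pd.
by rewrite mulmxDr mulmxDl !mulmxA -!mulmxA Ay By !mulmx0 addr0 mxE ltxx.
Qed.

(** [X] is (R; Q) times the inverse of the denominator, with the scalar of [adj_Wsys] absorbed. The
    denominator is the upper half of W (R; Q), so dividing by it leaves (1; -i phi), and K^* removes
    the factor K of W. The conditions on R and Q at -i give the cone property of X(0). *)
Lemma weyl_frame beta L (phi : C^o -> 'M[C]_p) :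
  (forall k, (k <= L)%N -> beta k *m Jmat R p *m adj (beta k) = 1%:M) ->
  is_Weyl (Cmat beta) L phi ->
  exists X : C -> 'M[C]_(p + p, p), [/\ mxlim 0 X (X 0),
    \forall z \near cnbhs 0, blaschke_prod (Cmat beta) 0 L.+1 z *m X z =
       adj K *m col_mx 1%:M (- ('i *: phi (mob z))) &
    forall x : 'cV[C]_p, (adj (X 0 *m x) *m j *m (X 0 *m x)) 0 0 <= 0 /\
       (X 0 *m x = 0 -> x = 0)].
Proof.
move=> hb [_ [Rf [Qf [_ _ Rreg Qreg H]]]].
pose V z := col_mx (Rf (mob z)) (Qf (mob z)).
pose W z := calW (Cmat beta) L (mob z).
pose c z : C := 2 / (z + 1).
pose den z := usubmx (W z *m V z).
pose X z := c z ^+ L.+1 *: (V z *m invmx (den z)).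
have Wz z : z + 1 != 0 -> z - 1 != 0 ->
    W z = c z ^+ L.+1 *: (K *m blaschke_prod (Cmat beta) 0 L.+1 z).
  move=> h1 h2; rewrite /W /calW adj_Wsys//; first by rewrite -scalemxAr.
  by move=> k; exact: Cmat_adj.
(* Regularity at -i holds at all nearby points too, so the defining formula of the Weyl function
   applies throughout a neighbourhood of [z = 0]. *)
have Hz : \forall z \near cnbhs 0, [/\ z + 1 != 0 /\ z - 1 != 0, den z \in unitmx &
    phi (mob z) = 'i *: (dsubmx (W z *m V z) *m invmx (den z))].
  have nR : \forall w \near cnbhs (- 'i), regular_at Rf w.
    exact: (@near_near R (- 'i) (fun w => derivable Rf w 1) Rreg).
  have nQ : \forall w \near cnbhs (- 'i), regular_at Qf w.
    exact: (@near_near R (- 'i) (fun w => derivable Qf w 1) Qreg).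
  have n3 : \forall w \near cnbhs (- 'i), [/\ lowerH (w : C), regular_at Rf w & regular_at Qf w].
    by apply: filterS3 near_lowerH nR nQ.
  apply: filterS2 near_mobius_poles (near_mobius n3) => z pm [l1 l2 l3].
  have [_ _ h3 h4] := H _ l1 l2 l3.
  by split => //; rewrite /den /V ?usubmx_mul ?dsubmx_mul.
have c1 : (c z ^+ L.+1 : C^o) @[z --> cnbhs 0] --> (c 0 ^+ L.+1 : C^o).
  have c0 : (c z : C^o) @[z --> cnbhs 0] --> (c 0 : C^o).
    apply: cvgM; first exact: cvg_cst.
    apply: cvgV; first by rewrite add0r oner_eq0.
    by apply: cvgD; [exact: ccont_id|exact: cvg_cst].
  elim: L.+1 => [|n IH]; first by under eq_fun do rewrite expr0; exact: cvg_cst.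
  under eq_fun do rewrite exprS; rewrite exprS; apply: cvgM; [exact: c0|exact: IH].
have Vl : mxlim 0 V (V 0).
  by rewrite {2}/V mobius0; apply: mxlim_col; exact: mxlim_regular.
have [[h1 h2] den0 _] := near_self Hz.
have Wl : mxlim 0 W (W 0).
  rewrite (Wz _ h1 h2).
  apply: (@mxlim_near _ _ _ _ (fun z => c z ^+ L.+1 *: (K *m blaschke_prod (Cmat beta) 0 L.+1 z))).
    by apply: filterS near_mobius_poles => z [z1 z2]; rewrite Wz.
  apply: mxlimZ; first exact: c1.
  by apply: mxlimM; [exact: mxlim_cst|exact: mxlim_blaschke_prod].
have denl : mxlim 0 den (den 0) by apply: mxlim_usub; exact: mxlimM.
have denu : \forall z \near cnbhs 0, den z \in unitmx by apply: filterS Hz => z [].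
exists X; split.
- apply: mxlimZ; first exact: c1.
  by apply: mxlimM; [exact: Vl|exact: mxlim_inv].
- apply: filterS Hz => z [[z1 z2] du phiE].
  have cV : blaschke_prod (Cmat beta) 0 L.+1 z *m X z = adj K *m (W z *m V z *m invmx (den z)).
    have aux (s : C) (U T P : 'M[C]_(p + p)) (A : 'M[C]_(p + p, p)) (B : 'M[C]_p) :
        U *m T = 1%:M -> P *m (s *: (A *m B)) = U *m (s *: (T *m P) *m A *m B).
      by move=> UT; rewrite -scalemxAr -!scalemxAl -scalemxAr !mulmxA UT mul1mx.
    by rewrite (Wz _ z1 z2) /X; apply: aux; exact: adjK_K.
  rewrite cV -[W z *m V z]vsubmxK mul_col_mx; congr (_ *m col_mx _ _).
    exact: mulmxV.
  by rewrite phiE scalerA -expr2 sqrCi scaleN1r opprK.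
- move=> x; have l0 : lowerH (mob 0) by rewrite mobius0; exact: (near_self near_lowerH).
  have r1 : regular_at Rf (mob 0) by rewrite mobius0; exact: Rreg.
  have r2 : regular_at Qf (mob 0) by rewrite mobius0; exact: Qreg.
  have [pd ps _ _] := H _ l0 r1 r2.
  (* Up to the invertible change of parameter from [x] to [y], the frame X(0) is (R; Q) at -i. *)
  pose y := c 0 ^+ L.+1 *: (invmx (den 0) *m x).
  have Xy : X 0 *m x = V 0 *m y.
    by rewrite /X /y -scalemxAl -scalemxAr mulmxA.
  have c0 : c 0 ^+ L.+1 != 0.
    by rewrite expf_neq0// /c add0r divr1 pnatr_eq0.
  have [p1 p2] := cone_col y pd ps.
  rewrite Xy; split; first exact: p1.
  move=> /p2 /eqP; rewrite /y scaler_eq0 (negPf c0) /= => /eqP dx.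
  by rewrite -[x]mul1mx -(mulmxV den0) -mulmxA dx mulmx0.
Qed.

End Weyl.

(** * Recovering the matrices C_k one at a time *)

Section Conclusion.
Variables (R : realType) (p : nat).
Local Notation C := (R[i]).
Local Notation N := (@cnorm R).
Local Notation j := (jmat R p).
Local Notation K := (Kmat R p).
Local Notation mob := (@mobius R).

Local Opaque blaschke_prod coblaschke_prod.

Definition weyl_z (phi : C^o -> 'M[C]_p) (z : C^o) : 'M[C]_p := 'i *: phi (mob z).

Lemma weyl_z_holomorphic (phi : C^o -> 'M[C]_p) : holo_on (@lowerH R) phi ->
  \forall z \near cnbhs 0, derivable (weyl_z phi) z 1.
Proof.
move=> hphi; apply/holomorphic_near_mxP => r s.
have n1 : \forall z \near cnbhs 0, lowerH (mob z) by exact: (near_mobius (near_lowerH R)).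
apply: filterS2 (near_mobius_poles R) n1 => z [_ z1] lz.
have [/derive_cder pd _] := derivable_mxE (hphi _ lz) r s.
have [d ld] := cder_mobius z1.
eexists; apply: (@cder_near _ (fun w => 'i * phi (mob w) r s)); last first.
  exact: (cderM (cder_cst 'i z) (cder_comp ld pd)).
by apply: filterE => w; rewrite mxE.
Qed.

Lemma taylor_order (phi psi : C^o -> 'M[C]_p) n :
  holo_on (@lowerH R) phi -> holo_on (@lowerH R) psi ->
  (forall k, (k <= n)%N -> taylor_coef phi k = taylor_coef psi k) ->
  forall r s (e : R), 0 < e ->
    \forall z \near cnbhs 0, N ((weyl_z phi z - weyl_z psi z) r s) <= e * N z ^+ n.
Proof.
move=> hphi hpsi tc r s e e0.
have fh := weyl_z_holomorphic hphi; have gh := weyl_z_holomorphic hpsi.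
have tc' k : (k <= n)%N -> derive1n k (weyl_z phi) 0 = derive1n k (weyl_z psi) 0.
  move=> /tc; rewrite /taylor_coef; apply: scalerI.
  by rewrite invr_eq0 pnatr_eq0 -lt0n fact_gt0.
have H := @peano_order R n (fun z => weyl_z phi z r s) (fun z => weyl_z psi z r s)
  ((holomorphic_near_mxP _ _).1 fh r s) ((holomorphic_near_mxP _ _).1 gh r s).
apply: filterS (H _ e e0) => [z|k kn]; first by rewrite !mxE.
by rewrite !derive1n_mxE// tc'.
Qed.

Lemma mul_cancel (Q U P A B : 'M[C]_(p + p)) (X Y u v w : 'M[C]_(p + p, p)) (s : C) :
  Q *m P = s%:M -> P *m A *m X = U *m u -> P *m B *m Y = U *m v -> w = u - v ->
  Q *m U *m w = s *: (A *m X - B *m Y).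
Proof.
move=> QP eX eY ->; rewrite -mulmxA mulmxBr -eX -eY -!mulmxA -mulmxBr mulmxA QP.
by rewrite mul_scalar_mx.
Qed.

(** Both products begin with the same [n] factors, which the cofactors reduce to z^n; the factors of
    index n to [Nt], respectively [Nh], remain. The identity blocks cancel in the difference of the
    right-hand sides. *)
Lemma blaschke_prod_cancel (Cs Ds : nat -> 'M[C]_(p + p)) Nt Nh n (z : C)
    (X Y : 'M[C]_(p + p, p)) (a b : 'M[C]_p) :
  (n <= Nt)%N -> (n <= Nh)%N -> (forall k, (k < n)%N -> Cs k = Ds k) ->
  (forall k, (k < n)%N -> Cproj Cs k *m Cproj Cs k = Cproj Cs k) ->
  blaschke_prod Cs 0 Nt.+1 z *m X = adj K *m col_mx 1%:M (- a) ->
  blaschke_prod Ds 0 Nh.+1 z *m Y = adj K *m col_mx 1%:M (- b) ->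
  (coblaschke_prod Cs n z *m adj K) *m col_mx 0 (- (a - b)) =
    z ^+ n *: (blaschke_prod Cs n (Nt - n).+1 z *m X - blaschke_prod Ds n (Nh - n).+1 z *m Y).
Proof.
move=> nNt nNh CD idem; have QP := coblaschke_prodK z idem.
have ext : blaschke_prod Ds 0 n z = blaschke_prod Cs 0 n z.
  by apply: blaschke_prod_ext => k /andP[_ kn]; rewrite CD.
rewrite -[in Nt.+1](subnKC nNt) -[in Nh.+1](subnKC nNh) -!addnS !blaschke_prod_cat ext !add0n.
move=> eX eY; apply: (mul_cancel QP eX eY).
by rewrite opp_col_mx add_col_mx subrr opprB opprK addrC.
Qed.

Lemma Cmat_determined (bt bh : nat -> 'M[C]_(p, p + p)) Nt Nh n phit phih :
  (forall k, (k <= Nt)%N -> bt k *m Jmat R p *m adj (bt k) = 1%:M) ->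
  (forall k, (k <= Nh)%N -> bh k *m Jmat R p *m adj (bh k) = 1%:M) ->
  is_Weyl (Cmat bt) Nt phit -> is_Weyl (Cmat bh) Nh phih ->
  (n <= Nt)%N -> (n <= Nh)%N ->
  (forall k, (k <= n)%N -> taylor_coef phit k = taylor_coef phih k) ->
  (forall k, (k < n)%N -> Cmat bt k = Cmat bh k) -> Cmat bt n = Cmat bh n.
Proof.
move=> hbt hbh Wt Wh nNt nNh tc Ceq.
have [Xt [Xtl Xt_eq Xt_cone]] := weyl_frame hbt Wt.
have [Xh [Xhl Xh_eq Xh_cone]] := weyl_frame hbh Wh.
have idem k : (k < n)%N -> Cproj (Cmat bt) k *m Cproj (Cmat bt) k = Cproj (Cmat bt) k.
  move=> kn; rewrite Cproj_proj proj_idem//; apply: betaK_j; apply: hbt.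
  exact: leq_trans (ltnW kn) nNt.
pose G beta L (X : C -> 'M[C]_(p + p, p)) z := blaschke_prod (Cmat beta) n (L - n).+1 z *m X z.
have Gl beta L X : mxlim 0 X (X 0) -> mxlim 0 (G beta L X) (G beta L X 0).
  by move=> Xl; apply: mxlimM; [exact: mxlim_blaschke_prod|exact: Xl].
have GE : \forall z \near cnbhs 0, (coblaschke_prod (Cmat bt) n z *m adj K) *m
     col_mx 0 (- (weyl_z phit z - weyl_z phih z)) = z ^+ n *: (G bt Nt Xt z - G bh Nh Xh z).
  by apply: filterS2 Xt_eq Xh_eq => z; exact: blaschke_prod_cancel.
(* Agreement of the coefficients up to and including index [n] gives o(z^n), which is what survives
   division by z^n; O(z^n) would leave a nonzero limit possible. *)
have G0 : G bt Nt Xt 0 - G bh Nh Xh 0 = 0.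
  apply: (cancel_order (n := n) (M0 := coblaschke_prod (Cmat bt) n 0 *m adj K) _ _ _ GE).
  - by apply: mxlimM; [exact: mxlim_coblaschke_prod|exact: mxlim_cst].
  - have -> : G bt Nt Xt 0 - G bh Nh Xh 0 = G bt Nt Xt 0 + (-1) *: G bh Nh Xh 0 by rewrite scaleN1r.
    apply: (@mxlim_near _ _ _ _ (fun z => G bt Nt Xt z + (-1) *: G bh Nh Xh z)).
      by apply: filterE => z; rewrite scaleN1r.
    by apply: mxlimD; [exact: Gl|apply: mxlimZ; [exact: cvg_cst|exact: Gl]].
  - case: Wt => ht _; case: Wh => hh _ => i s e e0.
    case: (split_ordP i) => r ->.
      apply: filterE => z; rewrite col_mxEu mxE cnorm0.
      by apply: mulr_ge0; [exact: ltW|apply: exprn_ge0; exact: cnorm_ge0].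
    apply: filterS (taylor_order ht hh tc r s e0) => z h.
    by rewrite col_mxEd mxE cnormN.
(* At z = 0 the leading factor is 1 - P_n, and b_n j (1 - P_n) = 0. *)
have kill (beta : nat -> 'M[C]_(p, p + p)) L X : beta n *m Jmat R p *m adj (beta n) = 1%:M ->
    beta n *m K *m j *m G beta L X 0 = 0.
  move=> /betaK_j bj; rewrite /G blaschke_prod_cons /blaschke scale0r addr0 Cproj_proj.
  by rewrite !mulmxA mulmxBr mulmx1 bj_proj// subrr !mul0mx.
have hbtn := hbt n nNt; have hbhn := hbh n nNh.
have Yeq : G bh Nh Xh 0 = G bt Nt Xt 0 by apply/esym/eqP; rewrite -subr_eq0; apply/eqP.
(* The vectors X(0) x are j-nonpositive, and on such vectors the product of the factors at 0 is
   injective, although each factor is a proper projection when p > 0. *)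
have Yinj (x : 'cV[C]_p) : G bt Nt Xt 0 *m x = 0 -> x = 0.
  have [x0 xinj] := Xt_cone x.
  have rng k : (n <= k < n + (Nt - n).+1)%N -> bt k *m Jmat R p *m adj (bt k) = 1%:M.
    by move=> /andP[_ kN]; apply: hbt; move: kN; rewrite addnS subnKC.
  have [_ inj2] := blaschke_prod0_cone rng x0.
  by rewrite /G -mulmxA => /inj2/xinj.
have kh : bh n *m K *m j *m G bt Nt Xt 0 = 0 by rewrite -Yeq; exact: kill.
have := row_space_unique (betaK_j hbtn) (betaK_j hbhn) Yinj (kill _ Nt Xt hbtn) kh.
by rewrite /Cmat !adjM !mulmxA => ->.
Qed.

End Conclusion.

Theorem theorem5p8 (R : realType) (p : nat) (hp : (0 < p)%N)
  (Nt Nh N : nat) (bt bh : nat -> 'M[R[i]]_(p, p + p))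
  (hbt : forall k, (k <= Nt)%N -> bt k *m Jmat R p *m adj (bt k) = 1%:M)
  (hbh : forall k, (k <= Nh)%N -> bh k *m Jmat R p *m adj (bh k) = 1%:M)
  (phit phih : R[i]^o -> 'M[R[i]]_p)
  (Wt : is_Weyl (Cmat bt) Nt phit)
  (Wh : is_Weyl (Cmat bh) Nh phih)
  (hN : (N <= minn Nt Nh)%N)
  (halpha : forall k, (k <= N)%N -> taylor_coef phit k = taylor_coef phih k) :
  forall k, (k <= N)%N -> Cmat bt k = Cmat bh k.
Proof.
move: hN; rewrite leq_min => /andP[NNt NNh].
(* Strong induction: [Cmat_determined] obtains C_n from all the earlier C_k and the coefficients up
   to index [n]. *)
elim/ltn_ind => n IH nN.
apply: (Cmat_determined hbt hbh Wt Wh).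
- exact: leq_trans nN NNt.
- exact: leq_trans nN NNh.
- by move=> k kn; apply: halpha; exact: leq_trans kn nN.
- by move=> k kn; apply: IH => //; exact: leq_trans (ltnW kn) nN.
Qed.
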